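(* Let $W$ be a finite Weyl group with simple reflections $s_1,\dots,s_n$. There is an isomorphism of superalgebras $$\dot\Phi:\ \mathcal C_{\mathfrak h^*}\rtimes_-\mathbb C W^-\ \xrightarrow{\ \simeq\ }\ \mathcal C_{\mathfrak h^*}\otimes\mathbb C W$$ which extends the identity map on $\mathcal C_{\mathfrak h^*}$ and sends $t_i\mapsto\beta_i s_i$ for each $i$. The inverse map $\dot\Psi$ is an extension of the identity map on $\mathcal C_{\mathfrak h^*}$ and sends $s_i\mapsto\beta_i t_i$ for each $i$.
   Context: All algebras are over $\mathbb C$. A superalgebra is a $\mathbb Z_2$-graded algebra; the tensor product of superalgebras has multiplication $(a\otimes b)(a'\otimes b')=(-1)^{|b||a'|}aa'\otimes bb'$ for homogeneous elements. $W$ is a finite Weyl group (of a complex simple Lie algebra, or of $gl_n$ in type $A_{n-1}$) with simple reflections $s_1,\dots,s_n$ and Coxeter relations $(s_is_j)^{m_{ij}}=1$. $\mathfrak h$ is the reflection representation (in type $A_{n-1}$ take $\mathfrak h=\mathbb C^n$, the Cartan subalgebra of $gl_n$), and $(-,-)$ is the standard $W$-invariant nondegenerate symmetric bilinear form on $\mathfrak h^*$ (restricted from the standard form on some $\mathbb C^N$). $\mathcal C_{\mathfrak h^*}$ is the Clifford algebra generated by $\mathfrak h^*$ with relations $ab+ba=(a,b)$ for $a,b\in\mathfrak h^*$. $W$ acts on it by algebra automorphisms $a\mapsto a^w$ extending the action on $\mathfrak h^*$. $\beta_i\in\mathfrak h^*\subset\mathcal C_{\mathfrak h^*}$ is the simple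 root $\alpha_i$ rescaled by a positive scalar so that $\beta_i^2=1$, i.e. $(\beta_i,\beta_i)=2$; thus $(\beta_i,\beta_j)=-2\cos(\pi/m_{ij})$. The spin Weyl group algebra $\mathbb C W^-$ is the algebra generated by $t_1,\dots,t_n$ subject to $(t_it_j)^{m_{ij}}=1$ if $m_{ij}\in\{1,3\}$ and $(t_it_j)^{m_{ij}}=-1$ if $m_{ij}\in\{2,4,6\}$; it is a superalgebra with each $t_i$ odd. $\mathcal C_{\mathfrak h^*}\rtimes_-\mathbb C W^-$ is the algebra generated by the subalgebras $\mathcal C_{\mathfrak h^*}$ and $\mathbb C W^-$ (as a vector space it is $\mathcal C_{\mathfrak h^*}\otimes\mathbb C W^-$) with the additional relations $t_i a=-a^{s_i}t_i$ for all $i$ and all $a\in\mathfrak h^*$; elements of $\mathfrak h^*$ and all $t_i$ are odd. In $\mathcal C_{\mathfrak h^*}\otimes\mathbb C W$ the elements of $\mathfrak h^*$ are odd and the elements of $W$ are even. *)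

(* Defs.v *)
From HB Require Import structures.
From mathcomp Require Import all_boot all_order all_algebra all_fingroup.
From mathcomp Require Import generic_quotient boolp reals complex.

Set Implicit Arguments.
Unset Strict Implicit.
Unset Printing Implicit Defensive.

Import Order.TTheory GRing.Theory Num.Theory.
Local Open Scope ring_scope.

(* An F-algebra is a ring with a ring morphism from F to its center: the      *)
(* algType of MathComp requires 1 != 0, which is a theorem and not a datum    *)
(* for algebras given by generators and relations. The grading                *)
(* A = A_0 (+) A_1 is given by its two projections, true being odd.           *)
HB.mixin Record isSuperalgebra (F : fieldType) A of GRing.PzRing A := {
  scst : F -> A;
  scst1 : scst 1 = 1;
  scstD : forall k l, scst (k + l) = scst k + scst l;
  scstM : forall k l, scst (k * l) = scst k * scst l;
  scstC : forall k x, scst k * x = x * scst k;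
  spart : bool -> A -> A;
  spartD : forall p x y, spart p (x + y) = spart p x + spart p y;
  spartZ : forall p k x, spart p (scst k * x) = scst k * spart p x;
  spart_sum : forall x, spart false x + spart true x = x;
  spartK : forall p q x, spart p (spart q x) = if p == q then spart q x else 0;
  spartM : forall p q x y, spart p x = x -> spart q y = y ->
    spart (p (+) q) (x * y) = x * y
}.

#[short(type="superalgType")]
HB.structure Definition Superalgebra (F : fieldType) :=
  { A of GRing.PzRing A & isSuperalgebra F A }.

Definition homog (F : fieldType) (A : superalgType F) (p : bool) (x : A) : Prop :=
  spart p x = x.

Record superalg_morphism (F : fieldType) (A B : superalgType F) (f : A -> B) :
    Prop := SuperalgMorphism {
  smorph_cst : forall k : F, f (scst k) = scst k;
  smorphD : forall x y, f (x + y) = f x + f y;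
  smorphM : forall x y, f (x * y) = f x * f y;
  smorph_homog : forall p x, homog p x -> homog p (f x)
}.

Section SuperTheory.
Variables (F : fieldType) (A : superalgType F).
Implicit Types x y : A.

Lemma spart0 p : spart p (0 : A) = 0.
Proof. by apply: (addrI (spart p (0 : A))); rewrite -spartD !addr0. Qed.

Lemma scst0 : scst 0 = 0 :> A.
Proof. by apply: (addrI (scst 0 : A)); rewrite -scstD !addr0. Qed.

Lemma scstN k : scst (- k) = - scst k :> A.
Proof. by apply: (addrI (scst k)); rewrite -scstD !subrr scst0. Qed.

Lemma scstCA k x y : x * (scst k * y) = scst k * (x * y).
Proof. by rewrite mulrA -scstC mulrA. Qed.

Lemma homog_spart p x : homog p (spart p x).
Proof. by rewrite /homog spartK eqxx. Qed.

Lemma spart_homog p q x : homog p x -> spart q x = if q == p then x else 0.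
Proof. by move=> hx; rewrite -{1}hx spartK; case: eqP => // _; rewrite hx. Qed.

Lemma homog0 p : homog p (0 : A). Proof. exact: spart0. Qed.

Lemma homogD p x y : homog p x -> homog p y -> homog p (x + y).
Proof. by rewrite /homog spartD => -> ->. Qed.

Lemma homogZ p k x : homog p x -> homog p (scst k * x).
Proof. by rewrite /homog spartZ => ->. Qed.

Lemma homogM p q x y : homog p x -> homog q y -> homog (p (+) q) (x * y).
Proof. exact: spartM. Qed.

Lemma homog1 : homog false (1 : A).
Proof.
have h q x : homog q x -> spart true 1 * x = 0.
  move=> hx; have /(congr1 (spart (~~ q))) :
    spart false 1 * x + spart true 1 * x = x by rewrite -mulrDl spart_sum mul1r.
  rewrite spartD (spart_homog _ (homogM (homog_spart false 1) hx)).
  rewrite (spart_homog _ (homogM (homog_spart true 1) hx)) (spart_homog _ hx).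
  by case: q {hx} => /=; rewrite add0r.
have e1 : spart true (1 : A) = 0.
  rewrite -[LHS]mulr1 -[X in _ * X = _](spart_sum 1) mulrDr.
  by rewrite !(h _ _ (homog_spart _ _)) addr0.
by rewrite /homog -[RHS]spart_sum e1 addr0.
Qed.

Lemma homog_cst k : homog false (scst k : A).
Proof. by rewrite -[scst k]mulr1; apply/homogZ/homog1. Qed.

Lemma homog_sign (b : bool) p x : homog p x -> homog p ((-1) ^+ b * x).
Proof.
by case: b => hx; rewrite ?mul1r // expr1 -scst1 -scstN; apply: homogZ.
Qed.

End SuperTheory.

(* Algebras presented by generators and relations: noncommutative polynomial  *)
(* expressions modulo the least congruence containing the algebra axioms and  *)
(* the relations.                                                             *)
Inductive term (F G : Type) : Type :=
| Gen of G
| Cst of F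
| Add of term F G & term F G
| Mul of term F G & term F G.
Arguments Gen {F G} g.
Arguments Cst {F G} k.

Fixpoint tmap (F G H : Type) (f : G -> H) (t : term F G) : term F H :=
  match t with
  | Gen g => Gen (f g)
  | Cst k => Cst k
  | Add x y => Add (tmap f x) (tmap f y)
  | Mul x y => Mul (tmap f x) (tmap f y)
  end.

Definition texp (F : fieldType) (G : Type) (t : term F G) (n : nat) : term F G :=
  iter n (Mul t) (Cst 1).

Fixpoint thomog (F G : Type) (par : G -> bool) (p : bool) (t : term F G) : bool :=
  match t with
  | Gen g => par g == p
  | Cst _ => ~~ p
  | Add x y => thomog par p x && thomog par p y
  | Mul x y => (thomog par false x && thomog par p y)
            || (thomog par true x && thomog par (~~ p) y)
  end.

Record presentation (F : fieldType) := Presentation {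
  pgen : Type;
  ppar : pgen -> bool;
  prel : term F pgen -> term F pgen -> Prop;
  prel_homog : forall t u, prel t u ->
    exists p, thomog ppar p t && thomog ppar p u
}.

Inductive teq (F : fieldType) (P : presentation F) :
    term F (pgen P) -> term F (pgen P) -> Prop :=
| teq_refl t : teq t t
| teq_sym t u : teq t u -> teq u t
| teq_trans u t v : teq t u -> teq u v -> teq t v
| teq_add t t' u u' : teq t t' -> teq u u' -> teq (Add t u) (Add t' u')
| teq_mul t t' u u' : teq t t' -> teq u u' -> teq (Mul t u) (Mul t' u')
| teq_addA t u v : teq (Add t (Add u v)) (Add (Add t u) v)
| teq_addC t u : teq (Add t u) (Add u t)
| teq_add0 t : teq (Add (Cst 0) t) t
| teq_addN t : teq (Add (Mul (Cst (-1)) t) t) (Cst 0)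
| teq_mulA t u v : teq (Mul t (Mul u v)) (Mul (Mul t u) v)
| teq_mul1 t : teq (Mul (Cst 1) t) t
| teq_mulDl t u v : teq (Mul (Add t u) v) (Add (Mul t v) (Mul u v))
| teq_mulDr t u v : teq (Mul v (Add t u)) (Add (Mul v t) (Mul v u))
| teq_cstC k t : teq (Mul (Cst k) t) (Mul t (Cst k))
| teq_cstD k l : teq (Cst (k + l)) (Add (Cst k) (Cst l))
| teq_cstM k l : teq (Cst (k * l)) (Mul (Cst k) (Cst l))
| teq_rel t u : prel t u -> teq t u.

Section PresentedAlgebra.
Variables (F : fieldType) (P : presentation F).

Definition pterm : Type := term F (pgen P).
HB.instance Definition _ := gen_eqMixin pterm.
HB.instance Definition _ := gen_choiceMixin pterm.

Definition teqb (t u : pterm) : bool := `[< teq t u >].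

Fact teqb_equiv : equiv_class_of teqb.
Proof.
split=> [t|t u|u t v]; first exact/asboolP/teq_refl.
  by apply/asboolP/asboolP; apply: teq_sym.
by move=> /asboolP h /asboolP h'; apply/asboolP; apply: teq_trans h h'.
Qed.
Canonical teqb_rel := EquivRelPack teqb_equiv.

Definition palg : Type := {eq_quot teqb_rel}%qT.
HB.instance Definition _ := Choice.on palg.
HB.instance Definition _ := EqQuotient.on palg.

Definition pclass (t : pterm) : palg := (\pi_palg t)%qT.
Definition prepr (x : palg) : pterm := repr x.

Lemma pclassP t u : pclass t = pclass u <-> teq t u.
Proof.
split; first by move/eqmodP => /asboolP.
by move=> h; apply/eqmodP/asboolP.
Qed.

Lemma preprK x : pclass (prepr x) = x. Proof. exact: reprK. Qed.
Lemma teq_prepr t : teq (prepr (pclass t)) t. Proof. exact/pclassP/preprK. Qed.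

Definition padd x y := pclass (Add (prepr x) (prepr y)).
Definition pmul x y := pclass (Mul (prepr x) (prepr y)).
Definition pcst k := pclass (Cst k).
Definition popp x := pmul (pcst (-1)) x.
Definition pscale k x := pmul (pcst k) x.

Lemma padd_class t u : padd (pclass t) (pclass u) = pclass (Add t u).
Proof. by apply/pclassP; apply: teq_add; apply: teq_prepr. Qed.
Lemma pmul_class t u : pmul (pclass t) (pclass u) = pclass (Mul t u).
Proof. by apply/pclassP; apply: teq_mul; apply: teq_prepr. Qed.

Lemma pclass_ind (Q : palg -> Prop) : (forall t, Q (pclass t)) -> forall x, Q x.
Proof. by move=> h x; rewrite -(preprK x). Qed.

Let pE := (padd_class, pmul_class).

Fact paddA : associative padd.
Proof.
by do 3!elim/pclass_ind => ?; rewrite !pE; apply/pclassP; apply: teq_addA.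
Qed.
Fact paddC : commutative padd.
Proof.
by do 2!elim/pclass_ind => ?; rewrite !pE; apply/pclassP; apply: teq_addC.
Qed.
Fact padd0 : left_id (pcst 0) padd.
Proof. by elim/pclass_ind => ?; rewrite !pE; apply/pclassP; apply: teq_add0. Qed.
Fact paddN : left_inverse (pcst 0) popp padd.
Proof.
by elim/pclass_ind => ?; rewrite /popp pmul_class padd_class; apply/pclassP;
  apply: teq_addN.
Qed.
Fact pmulA : associative pmul.
Proof.
by do 3!elim/pclass_ind => ?; rewrite !pE; apply/pclassP; apply: teq_mulA.
Qed.
Fact pmul1 : left_id (pcst 1) pmul.
Proof. by elim/pclass_ind => ?; rewrite !pE; apply/pclassP; apply: teq_mul1. Qed.
Fact pcstC k x : pmul (pcst k) x = pmul x (pcst k).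
Proof.
by elim/pclass_ind: x => ?; rewrite !pE; apply/pclassP; apply: teq_cstC.
Qed.
Fact pmul1r : right_id (pcst 1) pmul.
Proof. by move=> x; rewrite -pcstC pmul1. Qed.
Fact pmulDl : left_distributive pmul padd.
Proof.
by do 3!elim/pclass_ind => ?; rewrite !pE; apply/pclassP; apply: teq_mulDl.
Qed.
Fact pmulDr : right_distributive pmul padd.
Proof.
by do 3!elim/pclass_ind => ?; rewrite !pE; apply/pclassP; apply: teq_mulDr.
Qed.
Fact pcstD k l : pcst (k + l) = padd (pcst k) (pcst l).
Proof. by rewrite !pE; apply/pclassP; apply: teq_cstD. Qed.
Fact pcstM k l : pcst (k * l) = pmul (pcst k) (pcst l).
Proof. by rewrite !pE; apply/pclassP; apply: teq_cstM. Qed.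

HB.instance Definition _ := GRing.isZmodule.Build palg paddA paddC padd0 paddN.
HB.instance Definition _ :=
  GRing.Zmodule_isPzRing.Build palg pmulA pmul1 pmul1r pmulDl pmulDr.

Definition pgenerator (g : pgen P) : palg := pclass (Gen g).

Lemma pclass_Add t u : pclass (Add t u) = pclass t + pclass u.
Proof. by rewrite -padd_class. Qed.
Lemma pclass_Mul t u : pclass (Mul t u) = pclass t * pclass u.
Proof. by rewrite -pmul_class. Qed.

Fixpoint tpart (p : bool) (t : term F (pgen P)) : palg :=
  match t with
  | Gen g => if ppar g == p then pgenerator g else 0
  | Cst k => if p then 0 else pcst k
  | Add x y => tpart p x + tpart p y
  | Mul x y => tpart false x * tpart p y + tpart true x * tpart (~~ p) y
  end.

Lemma tpart_homog t p q :
  thomog (@ppar F P) p t -> tpart q t = if q == p then pclass t else 0.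
Proof.
elim: t p q => [g|k|x IHx y IHy|x IHx y IHy] p q /=.
- by move=> /eqP ->; rewrite eq_sym.
- by case: p; case: q.
- move=> /andP[/IHx -> /IHy ->]; rewrite pclass_Add.
  by case: eqP => // _; rewrite addr0.
- case/orP => /andP[/IHx hx /IHy hy]; rewrite !hx !hy pclass_Mul /=.
    by rewrite mul0r addr0; case: eqP => // _; rewrite mulr0.
  by rewrite mul0r add0r; case: p q {hx hy} => [] [] //=; rewrite mulr0.
Qed.

Lemma tpart_teq t u : teq t u -> forall p, tpart p t = tpart p u.
Proof.
elim=> {t u} /=.
- by [].
- by move=> t u _ IH p; rewrite IH.
- by move=> u t v _ IH _ IH' p; rewrite IH IH'.
- by move=> t t' u u' _ IH _ IH' p; rewrite IH IH'.
- by move=> t t' u u' _ IH _ IH' p; rewrite !IH !IH'.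
- by move=> t u v p; rewrite addrA.
- by move=> t u p; rewrite addrC.
- by move=> t []; rewrite add0r.
- move=> t p; rewrite mul0r addr0.
  by have -> : pcst (-1) * tpart p t = - tpart p t by []; rewrite addNr; case: p.
- move=> t u v p; rewrite negbK !mulrDr !mulrDl !mulrA.
  by rewrite [RHS]addrACA; congr (_ + _); rewrite addrC.
- by move=> t p; rewrite mul0r addr0 mul1r.
- by move=> t u v p; rewrite !mulrDl addrACA.
- by move=> t u v p; rewrite !mulrDr addrACA.
- move=> k t p; rewrite mul0r addr0 -[LHS]/(pmul _ _) pcstC.
  by case: p => /=; rewrite mulr0 ?add0r ?addr0.
- by move=> k l []; rewrite ?addr0 // pcstD.
- by move=> k l []; rewrite mul0r addr0 ?mulr0 // pcstM.
- move=> t u htu q; case: (prel_homog htu) => p /andP[ht hu].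
  rewrite (tpart_homog _ ht) (tpart_homog _ hu); case: eqP => // _.
  exact/pclassP/teq_rel.
Qed.

Definition ppart (p : bool) (x : palg) : palg := tpart p (prepr x).

Lemma ppart_class p t : ppart p (pclass t) = tpart p t.
Proof. by apply: tpart_teq; apply: teq_prepr. Qed.

Fact ppartD p x y : ppart p (x + y) = ppart p x + ppart p y.
Proof.
by elim/pclass_ind: x => x; elim/pclass_ind: y => y;
  rewrite -pclass_Add !ppart_class.
Qed.

Lemma ppart0 p : ppart p 0 = 0.
Proof. by rewrite ppart_class /=; case: p. Qed.

Lemma ppart_mul p x y : ppart p (x * y) =
  ppart false x * ppart p y + ppart true x * ppart (~~ p) y.
Proof.
by elim/pclass_ind: x => x; elim/pclass_ind: y => y;
  rewrite -pclass_Mul !ppart_class.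
Qed.

Fact ppartZ p k x : ppart p (pcst k * x) = pcst k * ppart p x.
Proof. by rewrite ppart_mul !ppart_class /= mul0r addr0. Qed.

Fact ppart_sum x : ppart false x + ppart true x = x.
Proof.
elim/pclass_ind: x => t; rewrite !ppart_class.
elim: t => [g|k|x IHx y IHy|x IHx y IHy] /=.
- by case: (ppar g); rewrite ?addr0 ?add0r.
- by rewrite addr0.
- by rewrite addrACA IHx IHy pclass_Add.
- rewrite pclass_Mul -IHx -IHy mulrDl !mulrDr [LHS]addrACA.
  by congr (_ + _); rewrite addrC.
Qed.

Fact ppartK p q x : ppart p (ppart q x) = if p == q then ppart q x else 0.
Proof.
elim/pclass_ind: x => t; rewrite !ppart_class.
elim: t p q => [g|k|x IHx y IHy|x IHx y IHy] p q /=.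
- case: (ppar g =P q) => [<-|_]; last by rewrite ppart0 if_same.
  by rewrite ppart_class /= eq_sym.
- case: q; first by rewrite ppart0 if_same.
  by rewrite ppart_class /=; case: p.
- by rewrite ppartD IHx IHy; case: eqP => // _; rewrite addr0.
- rewrite ppartD !ppart_mul !IHx !IHy /=.
  by case: p q => [] [] /=; rewrite ?mul0r ?mulr0 ?addr0 ?add0r.
Qed.

Fact ppartM p q x y : ppart p x = x -> ppart q y = y ->
  ppart (p (+) q) (x * y) = x * y.
Proof.
move=> <- <-; rewrite ppart_mul !ppartK.
by case: p q => [] [] /=; rewrite ?mul0r ?mulr0 ?addr0 ?add0r.
Qed.

HB.instance Definition _ := isSuperalgebra.Build F palg
  (erefl : pcst 1 = 1) pcstD pcstM pcstC
  ppartD ppartZ ppart_sum ppartK ppartM.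

End PresentedAlgebra.

Fixpoint teval (F : fieldType) (G : Type) (A : superalgType F) (f : G -> A)
    (t : term F G) : A :=
  match t with
  | Gen g => f g
  | Cst k => scst k
  | Add x y => teval f x + teval f y
  | Mul x y => teval f x * teval f y
  end.

Definition plift (F : fieldType) (P : presentation F) (A : superalgType F)
  (f : pgen P -> A) (x : palg P) : A := teval f (prepr x).

Section Lift.
Variables (F : fieldType) (P : presentation F) (A : superalgType F).
Variables (f : pgen P -> A).
Hypothesis fP : forall t u, prel t u -> teval f t = teval f u.

Lemma plift_class t : plift f (pclass t) = teval f t.
Proof.
rewrite /plift; move: (teq_prepr t); move: (prepr _) => u.
elim=> {t u} //=; try congruence.
- by move=> *; rewrite addrA.
- by move=> *; rewrite addrC.
- by move=> *; rewrite scst0 add0r.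
- by move=> *; rewrite scstN scst1 scst0 mulN1r addNr.
- by move=> *; rewrite mulrA.
- by move=> *; rewrite scst1 mul1r.
- by move=> *; rewrite mulrDl.
- by move=> *; rewrite mulrDr.
- by move=> *; rewrite scstC.
- by move=> *; rewrite scstD.
- by move=> *; rewrite scstM.
Qed.

Lemma plift_gen g : plift f (pgenerator g) = f g.
Proof. exact: plift_class. Qed.

Lemma plift_morphism :
  (forall g, homog (ppar g) (f g)) -> superalg_morphism (plift f).
Proof.
move=> fpar; split=> [k|x y|x y|p x].
- exact: plift_class.
- elim/pclass_ind: x => x; elim/pclass_ind: y => y.
  by rewrite -pclass_Add !plift_class.
- elim/pclass_ind: x => x; elim/pclass_ind: y => y.
  by rewrite -pclass_Mul !plift_class.
rewrite /homog; suff h : plift f (spart p x) = spart p (plift f x).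
  by move=> hx; rewrite -h hx.
elim/pclass_ind: x p => t p; rewrite plift_class -[spart p _]/(ppart p _).
rewrite ppart_class.
have plift0 : plift f 0 = 0 by rewrite plift_class /= scst0.
have pliftD x y : plift f (x + y) = plift f x + plift f y.
  elim/pclass_ind: x => x; elim/pclass_ind: y => y.
  by rewrite -pclass_Add !plift_class.
have pliftM x y : plift f (x * y) = plift f x * plift f y.
  elim/pclass_ind: x => x; elim/pclass_ind: y => y.
  by rewrite -pclass_Mul !plift_class.
elim: t p => [g|k|x IHx y IHy|x IHx y IHy] p /=.
- rewrite (spart_homog _ (fpar g)) eq_sym.
  by case: eqP => _; rewrite ?plift0 ?plift_gen.
- rewrite (spart_homog _ (homog_cst A k)).
  by case: p; rewrite ?plift0 //= plift_class.
- by rewrite pliftD IHx IHy spartD.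
- rewrite pliftD !pliftM !IHx !IHy.
  rewrite -[X in _ = spart p (X * _)]spart_sum.
  rewrite -[X in _ = spart p (_ * X)]spart_sum.
  rewrite mulrDl !mulrDr !spartD.
  do 4![rewrite (spart_homog _ (homogM (homog_spart _ _) (homog_spart _ _)))].
  by case: p; rewrite ?addr0 ?add0r.
Qed.

End Lift.

Section GroupAlgebra.
Variables (F : fieldType) (W : finGroupType).

Definition galg : Type := {ffun W -> F}.
HB.instance Definition _ := GRing.Zmodule.copy galg {ffun W -> F}.

Definition gelt (w : W) : galg := [ffun x => (x == w)%:R].
Definition gmul (f g : galg) : galg :=
  [ffun w => \sum_x f x * g (x^-1 * w)%g].

Fact gmulA : associative gmul.
Proof.
move=> f g h; apply/ffunP => w; rewrite !ffunE.
transitivity (\sum_x \sum_z f x * (g (x^-1 * z)%g * h (z^-1 * w)%g)).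
  apply: eq_bigr => x _; rewrite ffunE big_distrr /=.
  rewrite (reindex_inj (mulgI x^-1%g)) /=.
  by apply: eq_bigr => z _; rewrite invMg invgK mulgA mulgK.
rewrite exchange_big; apply: eq_bigr => z _; rewrite ffunE big_distrl.
by apply: eq_bigr => x _; rewrite mulrA.
Qed.

Fact gmul_cst k (f : galg) w : gmul [ffun x => k * (x == 1%g)%:R] f w = k * f w.
Proof.
rewrite ffunE (bigD1 1%g) //= ffunE eqxx mulr1 invg1 mul1g big1 ?addr0 // => x.
by move=> /negPf nx; rewrite ffunE nx mulr0 mul0r.
Qed.

Fact gmul_cstr k (f : galg) w : gmul f [ffun x => k * (x == 1%g)%:R] w = k * f w.
Proof.
rewrite ffunE (bigD1 w) //= ffunE mulVg eqxx mulr1 big1 ?addr0; first exact: mulrC.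
move=> x /negPf nx; rewrite ffunE -(inj_eq (mulgI x)) mulKVg mulg1 eq_sym nx.
by rewrite !mulr0.
Qed.

Fact gmul1 : left_id (gelt 1) gmul.
Proof.
move=> f; apply/ffunP => w; rewrite -[RHS]mul1r -gmul_cst; congr (gmul _ f w).
by apply/ffunP => x; rewrite !ffunE mul1r.
Qed.
Fact gmul1r : right_id (gelt 1) gmul.
Proof.
move=> f; apply/ffunP => w; rewrite -[RHS]mul1r -gmul_cstr; congr (gmul f _ w).
by apply/ffunP => x; rewrite !ffunE mul1r.
Qed.
Fact gmulDl : left_distributive gmul +%R.
Proof.
move=> f g h; apply/ffunP => w; rewrite !ffunE -big_split /=.
by apply: eq_bigr => x _; rewrite ffunE mulrDl.
Qed.
Fact gmulDr : right_distributive gmul +%R.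
Proof.
move=> f g h; apply/ffunP => w; rewrite !ffunE -big_split /=.
by apply: eq_bigr => x _; rewrite ffunE mulrDr.
Qed.

HB.instance Definition _ :=
  GRing.Zmodule_isPzRing.Build galg gmulA gmul1 gmul1r gmulDl gmulDr.

Definition gcst (k : F) : galg := [ffun x => k * (x == 1%g)%:R].
Definition gpart (p : bool) (f : galg) : galg := if p then 0 else f.

Fact gcst1 : gcst 1 = 1.
Proof. by apply/ffunP => x; rewrite !ffunE mul1r. Qed.
Fact gcstD k l : gcst (k + l) = gcst k + gcst l.
Proof. by apply/ffunP => x; rewrite !ffunE mulrDl. Qed.
Fact gcstM k l : gcst (k * l) = gcst k * gcst l.
Proof. by apply/ffunP => w; rewrite [RHS]gmul_cst !ffunE mulrA. Qed.
Fact gcstC k x : gcst k * x = x * gcst k.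
Proof. by apply/ffunP => w; rewrite [LHS]gmul_cst [RHS]gmul_cstr. Qed.
Fact gpartD p x y : gpart p (x + y) = gpart p x + gpart p y.
Proof. by case: p; rewrite //= addr0. Qed.
Fact gpartZ p k x : gpart p (gcst k * x) = gcst k * gpart p x.
Proof. by case: p; rewrite //= mulr0. Qed.
Fact gpart_sum x : gpart false x + gpart true x = x.
Proof. exact: addr0. Qed.
Fact gpartK p q x : gpart p (gpart q x) = if p == q then gpart q x else 0.
Proof. by case: p q => [] []. Qed.
Fact gpartM p q x y : gpart p x = x -> gpart q y = y ->
  gpart (p (+) q) (x * y) = x * y.
Proof.
case: p q => [] [] //= hx hy; first by rewrite -hx mul0r.
by rewrite -hy mulr0.
Qed.

HB.instance Definition _ := isSuperalgebra.Build F galg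
  gcst1 gcstD gcstM gcstC gpartD gpartZ gpart_sum gpartK gpartM.

End GroupAlgebra.

(* The tensor product over F of two F-algebras: the additive group generated  *)
(* by the a (x) b, biadditive and F-balanced.                                 *)
Inductive tterm (A B : Type) : Type :=
| TPure of A & B
| TZero
| TOpp of tterm A B
| TAdd of tterm A B & tterm A B.
Arguments TZero {A B}.

Inductive tens_eq (F : fieldType) (A B : superalgType F) :
    tterm A B -> tterm A B -> Prop :=
| tens_refl t : tens_eq t t
| tens_sym t u : tens_eq t u -> tens_eq u t
| tens_trans u t v : tens_eq t u -> tens_eq u v -> tens_eq t v
| tens_opp t t' : tens_eq t t' -> tens_eq (TOpp t) (TOpp t')
| tens_add t t' u u' :
    tens_eq t t' -> tens_eq u u' -> tens_eq (TAdd t u) (TAdd t' u')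
| tens_addA t u v : tens_eq (TAdd t (TAdd u v)) (TAdd (TAdd t u) v)
| tens_addC t u : tens_eq (TAdd t u) (TAdd u t)
| tens_add0 t : tens_eq (TAdd TZero t) t
| tens_addN t : tens_eq (TAdd (TOpp t) t) TZero
| tens_pureDl a a' b : tens_eq (TPure (a + a') b) (TAdd (TPure a b) (TPure a' b))
| tens_pureDr a b b' : tens_eq (TPure a (b + b')) (TAdd (TPure a b) (TPure a b'))
| tens_pureZ (k : F) a b :
    tens_eq (TPure (scst k * a) b) (TPure a (scst k * b)).

Section Tensor.
Variables (F : fieldType) (A B : superalgType F).

Definition tensor_term : Type := tterm A B.
HB.instance Definition _ := gen_eqMixin tensor_term.
HB.instance Definition _ := gen_choiceMixin tensor_term.

Definition tens_eqb (t u : tensor_term) : bool := `[< tens_eq t u >].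

Fact tens_eqb_equiv : equiv_class_of tens_eqb.
Proof.
split=> [t|t u|u t v]; first exact/asboolP/tens_refl.
  by apply/asboolP/asboolP; apply: tens_sym.
by move=> /asboolP h /asboolP h'; apply/asboolP; apply: tens_trans h h'.
Qed.
Canonical tens_eqb_rel := EquivRelPack tens_eqb_equiv.

Definition tensor : Type := {eq_quot tens_eqb_rel}%qT.
HB.instance Definition _ := Choice.on tensor.
HB.instance Definition _ := EqQuotient.on tensor.

Definition tclass (t : tensor_term) : tensor := (\pi_tensor t)%qT.
Definition trepr (x : tensor) : tensor_term := repr x.

Lemma tclassP t u : tclass t = tclass u <-> tens_eq t u.
Proof.
split; first by move/eqmodP => /asboolP.
by move=> h; apply/eqmodP/asboolP.
Qed.

Lemma treprK x : tclass (trepr x) = x. Proof. exact: reprK. Qed.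
Lemma tens_trepr t : tens_eq (trepr (tclass t)) t.
Proof. exact/tclassP/treprK. Qed.

Lemma tclass_ind (Q : tensor -> Prop) : (forall t, Q (tclass t)) -> forall x, Q x.
Proof. by move=> h x; rewrite -(treprK x). Qed.

Definition tadd x y := tclass (TAdd (trepr x) (trepr y)).
Definition topp x := tclass (TOpp (trepr x)).

Lemma tadd_class t u : tadd (tclass t) (tclass u) = tclass (TAdd t u).
Proof. by apply/tclassP; apply: tens_add; apply: tens_trepr. Qed.
Lemma topp_class t : topp (tclass t) = tclass (TOpp t).
Proof. by apply/tclassP; apply: tens_opp; apply: tens_trepr. Qed.

Fact taddA : associative tadd.
Proof.
by do 3!elim/tclass_ind => ?; rewrite !tadd_class; apply/tclassP/tens_addA.
Qed.
Fact taddC : commutative tadd.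
Proof.
by do 2!elim/tclass_ind => ?; rewrite !tadd_class; apply/tclassP/tens_addC.
Qed.
Fact tadd0 : left_id (tclass TZero) tadd.
Proof. by elim/tclass_ind => ?; rewrite tadd_class; apply/tclassP/tens_add0. Qed.
Fact taddN : left_inverse (tclass TZero) topp tadd.
Proof.
elim/tclass_ind => ?; rewrite topp_class tadd_class; exact/tclassP/tens_addN.
Qed.

HB.instance Definition _ := GRing.isZmodule.Build tensor taddA taddC tadd0 taddN.

Definition tens (a : A) (b : B) : tensor := tclass (TPure a b).

Lemma tensDl a a' b : tens (a + a') b = tens a b + tens a' b.
Proof. by rewrite [RHS]tadd_class; apply/tclassP/tens_pureDl. Qed.
Lemma tensDr a b b' : tens a (b + b') = tens a b + tens a b'.
Proof. by rewrite [RHS]tadd_class; apply/tclassP/tens_pureDr. Qed.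
Lemma tensZ k a b : tens (scst k * a) b = tens a (scst k * b).
Proof. exact/tclassP/tens_pureZ. Qed.
Lemma tens0l b : tens 0 b = 0.
Proof. by apply: (addrI (tens 0 b)); rewrite -tensDl !addr0. Qed.
Lemma tens0r a : tens a 0 = 0.
Proof. by apply: (addrI (tens a 0)); rewrite -tensDr !addr0. Qed.

Lemma tens_ind (Q : tensor -> Prop) :
  (forall x y, Q x -> Q y -> Q (x + y)) ->
  (forall p q a b, homog p a -> homog q b -> Q (tens a b)) -> forall x, Q x.
Proof.
move=> QD Qh x.
have Qt a b : Q (tens a b).
  rewrite -(spart_sum a) -(spart_sum b) tensDl !tensDr.
  by apply: (QD); apply: (QD); apply: (Qh _ _ _ _ (homog_spart _ _) (homog_spart _ _)).
suff h t : Q (tclass t) /\ Q (- tclass t) by rewrite -(treprK x); case: (h (trepr x)).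
elim: t => [a b||t [h1 h2]|t [h1 h2] u [h3 h4]].
- split; first exact: Qt.
  suff -> : - tclass (TPure a b) = tens (- a) b by exact: Qt.
  by apply/eqP; rewrite eq_sym -addr_eq0 -tensDl addNr tens0l.
- by have := Qt 0 0; rewrite tens0l oppr0; split.
- by rewrite -topp_class opprK; split.
- by rewrite -tadd_class opprD; split; apply: QD.
Qed.

Section Lift.
Variables (V : zmodType) (f : A -> B -> V).

Fixpoint teval_tens (t : tterm A B) : V :=
  match t with
  | TPure a b => f a b
  | TZero => 0
  | TOpp t => - teval_tens t
  | TAdd t u => teval_tens t + teval_tens u
  end.

Definition tlift (x : tensor) : V := teval_tens (trepr x).

Definition balanced : Prop :=
  [/\ forall a a' b, f (a + a') b = f a b + f a' b,
      forall a b b', f a (b + b') = f a b + f a b'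
    & forall k a b, f (scst k * a) b = f a (scst k * b)].

Hypothesis fP : balanced.

Lemma tlift_class t : tlift (tclass t) = teval_tens t.
Proof.
have [fDl fDr fZ] := fP.
rewrite /tlift; move: (tens_trepr t); move: (trepr _) => u.
elim=> {t u} //=; try congruence.
- by move=> *; rewrite addrA.
- by move=> *; rewrite addrC.
- by move=> *; rewrite add0r.
- by move=> *; rewrite addNr.
Qed.

Lemma tlift_tens a b : tlift (tens a b) = f a b.
Proof. exact: tlift_class. Qed.

Lemma tliftD x y : tlift (x + y) = tlift x + tlift y.
Proof.
elim/tclass_ind: x => x; elim/tclass_ind: y => y.
by rewrite -[_ + _]/(tadd _ _) tadd_class !tlift_class.
Qed.

End Lift.

(* (a (x) b) (a' (x) b') = (-1)^(|b||a'|) aa' (x) bb', summed over the parts  *)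
(* of b and a'; tensM below is the usual form, on homogeneous elements.        *)
Definition tmul_pure (a : A) (b : B) (a' : A) (b' : B) : tensor :=
  \sum_(p : bool) \sum_(q : bool)
    tens ((-1) ^+ (q && p) * (a * spart p a')) (spart q b * b').

Definition tmul (x y : tensor) : tensor :=
  tlift (fun a b => tlift (fun a' b' => tmul_pure a b a' b') y) x.

Fact tmul_pure_balr a b : balanced (tmul_pure a b).
Proof.
split=> [a1 a2 b'|a' b1 b2|k a' b']; rewrite /tmul_pure -?big_split /=;
  apply: eq_bigr => p _; rewrite -?big_split /=; apply: eq_bigr => q _.
- by rewrite spartD !mulrDr tensDl.
- by rewrite mulrDr tensDr.
- by rewrite spartZ !scstCA tensZ.
Qed.

Fact tmul_pure_ball a' b' : balanced (fun a b => tmul_pure a b a' b').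
Proof.
split=> [a1 a2 b|a b1 b2|k a b]; rewrite /tmul_pure -?big_split /=;
  apply: eq_bigr => p _; rewrite -?big_split /=; apply: eq_bigr => q _.
- by rewrite mulrDl !mulrDr tensDl.
- by rewrite spartD !mulrDl tensDr.
- by rewrite spartZ -!mulrA scstCA tensZ.
Qed.

Lemma tmulDr x y z : tmul x (y + z) = tmul x y + tmul x z.
Proof.
rewrite /tmul /tlift; elim: (trepr x) => [a b||t IH|t IHt u IHu] /=.
- exact/tliftD/tmul_pure_balr.
- by rewrite addr0.
- by rewrite IH opprD.
- by rewrite IHt IHu addrACA.
Qed.

Fact tmul_ball y : balanced (fun a b => tlift (fun a' b' => tmul_pure a b a' b') y).
Proof.
rewrite /tlift.
split=> [a1 a2 b|a b1 b2|k a b];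
  elim: (trepr y) => [a' b'||t IH|t IHt u IHu] /=;
  rewrite ?addr0 ?IH ?IHt ?IHu ?opprD 1?addrACA //;
  by have [hDl hDr hZ] := tmul_pure_ball a' b'; rewrite ?hDl ?hDr ?hZ.
Qed.

Lemma tmulDl x y z : tmul (x + y) z = tmul x z + tmul y z.
Proof. exact/tliftD/tmul_ball. Qed.

Lemma tmul_tens a b a' b' : tmul (tens a b) (tens a' b') = tmul_pure a b a' b'.
Proof.
rewrite /tmul tlift_tens; last exact: tmul_ball.
by rewrite tlift_tens //; apply: tmul_pure_balr.
Qed.

Lemma tmul_homog p q a b a' b' : homog q b -> homog p a' ->
  tmul (tens a b) (tens a' b') = tens ((-1) ^+ (q && p) * (a * a')) (b * b').
Proof.
move=> hb ha; rewrite tmul_tens /tmul_pure !big_bool /=.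
rewrite !(spart_homog _ hb) !(spart_homog _ ha).
case: p q {hb ha} => [] [] /=;
  by rewrite ?mulr0 ?mul0r ?tens0l ?tens0r ?add0r ?addr0.
Qed.

Fact tmulA : associative tmul.
Proof.
elim/tens_ind => [x x' hx hx' y z|p1 q1 a1 b1 ha1 hb1].
  by rewrite !tmulDl hx hx'.
elim/tens_ind => [x x' hx hx' z|p2 q2 a2 b2 ha2 hb2].
  by rewrite !(tmulDl, tmulDr) hx hx'.
elim/tens_ind => [x x' hx hx'|p3 q3 a3 b3 ha3 hb3].
  by rewrite !tmulDr hx hx'.
rewrite (tmul_homog _ _ hb2 ha3) (tmul_homog _ _ hb1 ha2).
rewrite (tmul_homog _ _ hb1 (homog_sign _ (homogM ha2 ha3))).
rewrite (tmul_homog _ _ (homogM hb1 hb2) ha3).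
rewrite mulrA; congr (tens _ _).
case: q1 q2 p2 p3 {hb1 hb2 ha2 ha3} => [] [] [] [] /=;
  by rewrite ?(expr0, expr1, mul1r, mulN1r, mulrN, mulNr, opprK, mulrA).
Qed.

Fact tmul1 : left_id (tens 1 1) tmul.
Proof.
elim/tens_ind => [x y hx hy|p q a b ha hb]; first by rewrite tmulDr hx hy.
by rewrite (tmul_homog _ _ (homog1 B) ha) /= !mul1r.
Qed.

Fact tmul1r : right_id (tens 1 1) tmul.
Proof.
elim/tens_ind => [x y hx hy|p q a b ha hb]; first by rewrite tmulDl hx hy.
by rewrite (tmul_homog _ _ hb (homog1 A)) andbF mul1r !mulr1.
Qed.

HB.instance Definition _ := GRing.Zmodule_isPzRing.Build tensor
  tmulA tmul1 tmul1r (fun x y z => tmulDl x y z) (fun x y z => tmulDr x y z).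

Definition tcst (k : F) : tensor := tens (scst k) 1.

Lemma tcst_mul k a b : tcst k * tens a b = tens (scst k * a) b.
Proof.
rewrite -(spart_sum a) mulrDr !tensDl mulrDr; congr (_ + _);
  rewrite [LHS](tmul_homog _ _ (homog1 B) (homog_spart _ _)) /=;
  by rewrite !mul1r.
Qed.

Fact tcst1 : tcst 1 = 1. Proof. by rewrite /tcst scst1. Qed.
Fact tcstD k l : tcst (k + l) = tcst k + tcst l.
Proof. by rewrite /tcst scstD tensDl. Qed.
Fact tcstM k l : tcst (k * l) = tcst k * tcst l.
Proof. by rewrite tcst_mul -scstM. Qed.
Fact tcstC k x : tcst k * x = x * tcst k.
Proof.
elim/tens_ind: x => [x y hx hy|p q a b ha hb]; first by rewrite mulrDr mulrDl hx hy.
rewrite tcst_mul [RHS](tmul_homog _ _ hb (homog_cst A k)) andbF mul1r mulr1.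
by rewrite scstC.
Qed.

Definition tpart_pure (p : bool) (a : A) (b : B) : tensor :=
  \sum_(q : bool) tens (spart q a) (spart (q (+) p) b).
Definition tens_part (p : bool) (x : tensor) : tensor := tlift (tpart_pure p) x.

Fact tpart_bal p : balanced (tpart_pure p).
Proof.
split=> [a1 a2 b|a b1 b2|k a b]; rewrite /tpart_pure -?big_split /=;
  apply: eq_bigr => q _.
- by rewrite spartD tensDl.
- by rewrite spartD tensDr.
- by rewrite !spartZ tensZ.
Qed.

Fact tens_partD p x y : tens_part p (x + y) = tens_part p x + tens_part p y.
Proof. exact/tliftD/tpart_bal. Qed.

Lemma tens_part_homog r p q a b : homog p a -> homog q b ->
  tens_part r (tens a b) = if r == p (+) q then tens a b else 0.
Proof.
move=> ha hb; rewrite /tens_part tlift_tens; last exact: tpart_bal.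
rewrite /tpart_pure big_bool /= !(spart_homog _ ha) !(spart_homog _ hb).
case: p q r {ha hb} => [] [] [] /=;
  by rewrite ?tens0l ?tens0r ?add0r ?addr0.
Qed.

Fact tens_partZ p k x : tens_part p (tcst k * x) = tcst k * tens_part p x.
Proof.
elim/tens_ind: x => [x y hx hy|q r a b ha hb].
  by rewrite mulrDr !tens_partD hx hy mulrDr.
rewrite tcst_mul (tens_part_homog _ (homogZ k ha) hb) (tens_part_homog _ ha hb).
by case: eqP => _; rewrite ?tcst_mul ?mulr0.
Qed.

Fact tens_part_sum x : tens_part false x + tens_part true x = x.
Proof.
elim/tens_ind: x => [x y hx hy|q r a b ha hb].
  by rewrite !tens_partD addrACA hx hy.
by rewrite !(tens_part_homog _ ha hb); case: (q (+) r); rewrite ?add0r ?addr0.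
Qed.

Lemma tens_part0 p : tens_part p 0 = 0.
Proof. by apply: (addrI (tens_part p 0)); rewrite -tens_partD !addr0. Qed.

Fact tens_partK p q x :
  tens_part p (tens_part q x) = if p == q then tens_part q x else 0.
Proof.
elim/tens_ind: x => [x y hx hy|r s a b ha hb].
  by rewrite !tens_partD hx hy; case: eqP => // _; rewrite addr0.
rewrite !(tens_part_homog _ ha hb).
case: (q =P r (+) s) => [->|_]; last by rewrite tens_part0 if_same.
by rewrite (tens_part_homog _ ha hb).
Qed.

Lemma tens_part_mul p x y : tens_part p (x * y) =
  tens_part false x * tens_part p y + tens_part true x * tens_part (~~ p) y.
Proof.
elim/tens_ind: x => [x x' hx hx'|p1 q1 a1 b1 ha1 hb1].
  by rewrite mulrDl !tens_partD hx hx' !mulrDl addrACA.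
elim/tens_ind: y => [y y' hy hy'|p2 q2 a2 b2 ha2 hb2].
  by rewrite mulrDr !tens_partD hy hy' !mulrDr addrACA.
have e : tens a1 b1 * tens a2 b2 =
    tens ((-1) ^+ (q1 && p2) * (a1 * a2)) (b1 * b2) by exact: tmul_homog.
rewrite !(tens_part_homog _ ha1 hb1) !(tens_part_homog _ ha2 hb2) {1}e.
rewrite (tens_part_homog _ (homog_sign _ (homogM ha1 ha2)) (homogM hb1 hb2)) -e.
by case: p p1 q1 p2 q2 {ha1 hb1 ha2 hb2 e} => [] [] [] [] [] /=;
  rewrite ?mul0r ?mulr0 ?add0r ?addr0.
Qed.

Fact tens_partM p q x y : tens_part p x = x -> tens_part q y = y ->
  tens_part (p (+) q) (x * y) = x * y.
Proof.
move=> <- <-; rewrite tens_part_mul !tens_partK.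
by case: p q => [] [] /=; rewrite ?mul0r ?mulr0 ?addr0 ?add0r.
Qed.

HB.instance Definition _ := isSuperalgebra.Build F tensor
  tcst1 tcstD tcstM tcstC
  tens_partD tens_partZ tens_part_sum tens_partK tens_partM.

Lemma tensM p q (a : A) (b : B) (a' : A) (b' : B) : homog q b -> homog p a' ->
  tens a b * tens a' b' = (-1) ^+ (q && p) * tens (a * a') (b * b').
Proof.
move=> hb ha; rewrite [LHS](tmul_homog _ _ hb ha).
case: (q && p); last by rewrite !mul1r.
by rewrite expr1 !mulN1r; apply/eqP; rewrite -addr_eq0 -tensDl addNr tens0l.
Qed.

End Tensor.

Lemma thomog_exp (F : fieldType) (G : Type) (par : G -> bool) (t : term F G) n :
  thomog par false t -> thomog par false (texp t n).
Proof. by move=> ht; elim: n => //= n ->; rewrite ht. Qed.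

Section CliffordSpin.
Variables (F : fieldType) (V : lmodType F) (form : V -> V -> F).

Inductive clifford_rel : term F V -> term F V -> Prop :=
| clifford_linear k a b :
    clifford_rel (Gen (k *: a + b)) (Add (Mul (Cst k) (Gen a)) (Gen b))
| clifford_anticomm a b :
    clifford_rel (Add (Mul (Gen a) (Gen b)) (Mul (Gen b) (Gen a)))
                 (Cst (form a b)).

Fact clifford_homog t u : clifford_rel t u ->
  exists p, thomog xpredT p t && thomog xpredT p u.
Proof. by case=> *; [exists true | exists false]. Qed.

Definition clifford_pres : presentation F := Presentation clifford_homog.
Definition clifford : superalgType F := palg clifford_pres.
Definition cvec (a : V) : clifford := @pgenerator F clifford_pres a.

Variables (n : nat) (m : 'I_n -> 'I_n -> nat).

Inductive spin_rel : term F 'I_n -> term F 'I_n -> Prop :=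
| spin_plus i j : m i j \in [:: 1; 3]%N ->
    spin_rel (texp (Mul (Gen i) (Gen j)) (m i j)) (Cst 1)
| spin_minus i j : m i j \in [:: 2; 4; 6]%N ->
    spin_rel (texp (Mul (Gen i) (Gen j)) (m i j)) (Cst (-1)).

Fact spin_homog t u : spin_rel t u ->
  exists p, thomog xpredT p t && thomog xpredT p u.
Proof. by case=> *; exists false; rewrite thomog_exp. Qed.

Definition spin_pres : presentation F := Presentation spin_homog.
Definition spin : superalgType F := palg spin_pres.
Definition spin_t (i : 'I_n) : spin := @pgenerator F spin_pres i.

Variable sigma : 'I_n -> V -> V.

Inductive smash_rel : term F (V + 'I_n) -> term F (V + 'I_n) -> Prop :=
| smash_clifford t u : clifford_rel t u -> smash_rel (tmap inl t) (tmap inl u)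
| smash_spin t u : spin_rel t u -> smash_rel (tmap inr t) (tmap inr u)
| smash_cross i a :
    smash_rel (Mul (Gen (inr i)) (Gen (inl a)))
              (Mul (Cst (-1)) (Mul (Gen (inl (sigma i a))) (Gen (inr i)))).

Lemma thomog_tmap (G H : Type) (f : G -> H) p (t : term F G) :
  thomog xpredT p (tmap f t) = thomog xpredT p t.
Proof. by elim: t p => //= [t IHt u IHu|t IHt u IHu] p; rewrite !IHt !IHu. Qed.

Fact smash_homog t u : smash_rel t u ->
  exists p, thomog xpredT p t && thomog xpredT p u.
Proof.
case=> [{}t {}u /clifford_homog[p h]|{}t {}u /spin_homog[p h]|i a].
- by exists p; rewrite !thomog_tmap.
- by exists p; rewrite !thomog_tmap.
- by exists false.
Qed.

Definition smash_pres : presentation F := Presentation smash_homog.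
Definition smash : superalgType F := palg smash_pres.

Definition smash_cliff : clifford -> smash :=
  @plift F clifford_pres smash (fun a => @pgenerator F smash_pres (inl a)).
Definition smash_spn : spin -> smash :=
  @plift F spin_pres smash (fun i => @pgenerator F smash_pres (inr i)).

Lemma teval_tmap (G : Type) (f : G -> V + 'I_n) (t : term F G) :
  teval (A := smash) (fun g => @pgenerator F smash_pres (f g)) t =
  @pclass F smash_pres (tmap f t).
Proof.
by elim: t => //= t -> u ->; rewrite ?(pclass_Add (P := smash_pres))
  ?(pclass_Mul (P := smash_pres)).
Qed.

Lemma smash_cliff_morphism : superalg_morphism smash_cliff.
Proof.
apply: plift_morphism => [t u htu|a]; last exact/ppart_class.
by rewrite !teval_tmap; apply/pclassP/teq_rel/smash_clifford.
Qed.

Lemma smash_spn_morphism : superalg_morphism smash_spn.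
Proof.
apply: plift_morphism => [t u htu|a]; last exact/ppart_class.
by rewrite !teval_tmap; apply/pclassP/teq_rel/smash_spin.
Qed.

End CliffordSpin.

Section RootSystems.
Variable R : realType.

(* Bilinear, also over the complex numbers. *)
Definition dot (K : fieldType) (N : nat) (u v : 'rV[K]_N) : K :=
  \sum_j u 0 j * v 0 j.

Definition reflection (K : fieldType) (N : nat) (a v : 'rV[K]_N) : 'rV[K]_N :=
  v - (2 * dot v a / dot a a) *: a.

Definition cplx (N : nat) (v : 'rV[R]_N) : 'rV[R[i]]_N :=
  map_mx (real_complex R) v.

Record irreducible_root_system (N : nat) (Phi : seq 'rV[R]_N) : Prop := {
  roots_neq0 : 0 \notin Phi;
  roots_reflection : {in Phi &, forall a b, reflection a b \in Phi};
  roots_integral : {in Phi &, forall a b, 2 * dot b a / dot a a \is a Num.int};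
  roots_reduced : {in Phi, forall a k, k *: a \in Phi -> k = 1 \/ k = -1};
  roots_nonempty : Phi != [::];
  roots_irreducible : forall S : pred 'rV[R]_N,
    {in Phi &, forall a b, S a -> ~~ S b -> dot a b = 0} ->
    {in Phi, forall a, S a} \/ {in Phi, forall a, ~~ S a}
}.

Record simple_system (N n : nat) (Phi : seq 'rV[R]_N)
    (alpha : 'I_n -> 'rV[R]_N) : Prop := {
  simple_root : forall i, alpha i \in Phi;
  simple_free : free [seq alpha i | i <- enum 'I_n];
  simple_base : {in Phi, forall a, exists c : 'I_n -> nat,
    a = \sum_i (c i)%:R *: alpha i \/ a = - \sum_i (c i)%:R *: alpha i}
}.

(* The simple roots alpha in R^N together with the complex space h* they act  *)
(* on: either h* is the complex span of an irreducible reduced                *)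
(* crystallographic root system (a Cartan subalgebra of a complex simple Lie  *)
(* algebra, up to duality), or h* = C^(n+1) with the simple roots             *)
(* e_i - e_(i+1) of gl_(n+1).                                                 *)
Variant weyl_roots (N n : nat) (alpha : 'I_n -> 'rV[R]_N) :
    {vspace 'rV[R[i]]_N} -> Prop :=
| SimpleLieRoots (Phi : seq 'rV[R]_N) of
    irreducible_root_system Phi & simple_system Phi alpha :
    weyl_roots alpha <<[seq cplx (alpha i) | i <- enum 'I_n]>>%VS
| GeneralLinearRoots of N = n.+1 &
    (forall i (j : 'I_N),
       alpha i 0 j = ((j : nat) == i)%:R - ((j : nat) == i.+1)%:R) :
    weyl_roots alpha fullv.

(* A finite Weyl group: a finite group acting faithfully on h*, generated by  *)
(* elements s_i acting as the reflections in the simple roots.                *)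
Record weyl_group := WeylGroup {
  wdim : nat;
  wrank : nat;
  wroot : 'I_wrank -> 'rV[R]_wdim;
  wspace : {vspace 'rV[R[i]]_wdim};
  wrootP : weyl_roots wroot wspace;
  wgroup :> finGroupType;
  wrefl : 'I_wrank -> wgroup;
  wact : wgroup -> 'End(subvs_of wspace);
  wact1 : wact 1%g = \1%VF;
  wactM : forall v w, wact (v * w)%g = (wact v \o wact w)%VF;
  wact_inj : injective wact;
  wact_refl : forall i a,
    vsval (wact (wrefl i) a) = reflection (cplx (wroot i)) (vsval a);
  wrefl_gen : <<[set wrefl i | i : 'I_wrank]>>%g = [set: wgroup]
}.

Variable W : weyl_group.

Definition hdual : vectType R[i] := subvs_of (wspace W).
Definition hform (a b : hdual) : R[i] := dot (vsval a) (vsval b).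
Definition coxeter_m (i j : 'I_(wrank W)) : nat := #[wrefl i * wrefl j]%g.

(* vsproj is the identity here, as beta_vector lies in wspace: see vsval_beta *)
Definition beta_vector (i : 'I_(wrank W)) : 'rV[R[i]]_(wdim W) :=
  cplx (Num.sqrt (2 / dot (wroot i) (wroot i)) *: wroot i).
Definition beta (i : 'I_(wrank W)) : hdual := vsproj (wspace W) (beta_vector i).

Lemma vsval_beta i : vsval (beta i) = beta_vector i.
Proof.
apply: vsprojK; rewrite /beta_vector /cplx map_mxZ memvZ //.
case: (wrootP W) => [Phi _ _|_ _]; last exact: memvf.
by apply/memv_span/map_f; rewrite mem_enum.
Qed.

Definition weyl_clifford : superalgType R[i] := clifford hform.
Definition weyl_spin : superalgType R[i] := spin R[i] coxeter_m.
Definition weyl_smash : superalgType R[i] :=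
  smash hform coxeter_m (fun i => wact (wrefl i)).
Definition weyl_tensor : superalgType R[i] :=
  tensor weyl_clifford (galg R[i] W).

Definition smash_c : weyl_clifford -> weyl_smash := @smash_cliff _ _ _ _ _ _.
Definition smash_t (i : 'I_(wrank W)) : weyl_smash :=
  smash_spn hform _ (spin_t R[i] coxeter_m i).
Definition cbeta (i : 'I_(wrank W)) : weyl_clifford := cvec hform (beta i).
Definition tensor_c (c : weyl_clifford) : weyl_tensor := tens c 1.
Definition tensor_w (w : W) : weyl_tensor := tens 1 (gelt R[i] w).

End RootSystems.

(* Main.v *)
Require Import Defs.
From HB Require Import structures.
From mathcomp Require Import all_boot all_order all_algebra all_fingroup.
From mathcomp Require Import cyclic reals complex ring lra.

(** Write xi(a) for a vector a of h* inside the Clifford algebra. As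
    xi(beta_i)^2 = 1 and xi(a) xi(b) + xi(b) xi(a) = (a, b), conjugation by
    xi(beta_i) is minus the reflection s_i on vectors (cliff_reflection). So in
    the smash product, where conjugation by t_i is also minus s_i, the element
    beta_i t_i commutes with the Clifford algebra; and in the tensor product
    beta_i s_i satisfies the cross relation demanded of t_i. Both maps of the
    theorem are therefore dictated by their values on generators, and they are
    mutually inverse because beta_i^2 = 1. What has to be proved is that each
    respects the defining relations of its source.

    For the map out of the smash product, the relation on (t_i t_j)^m, where m
    is the order of s_i s_j, comes down to computing (beta_i beta_j)^m. With
    d = - (beta_i, beta_j), the element z = - beta_i beta_j satisfies
    z^2 = d z - 1, so z^k = U_k(d) z - U_(k-1)(d) for the sequence U_0 = 0,
    U_1 = 1, U_(k+2) = d U_(k+1) - U_k (called cheb below). Simple roots being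
    obtuse and the system crystallographic, d^2 is 0, 1, 2 or 3 and d >= 0; then
    m is the first positive zero of U (bond_order), and (beta_i beta_j)^m
    is - (-1)^m (cliff_mul_period), the sign in the spin relations.

    For the map out of the group algebra, one needs that W is presented by the
    relations (s_i s_j)^m = 1, since these are the only relations that the
    beta_i t_i are known to satisfy (psi_rel). Given elements g_i of a ring
    satisfying them, define F(w) by repeatedly removing a left descent from w,
    recording the corresponding g_i. If i and j are both descents of w, the
    roots x beta_i + y beta_j with x, y >= 0 are all sent to negative roots by
    w^-1, so that either letter may start a removal of the whole alternating word
    of length m; the two words agree in W and their counterparts in the g_i agree
    by the braid relation, so F does not depend on the choice
    (lift_elt_descent). Hence F (s_i w) = g_i F(w) for all i and w, and F is
    multiplicative (coxeter_presentation). The geometric input is again the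
    sequence U: k alternating reflections applied to a simple root give
    U_(k+1) beta_i + U_k beta_j (alt_beta), with nonnegative coefficients as long
    as k < m.

    The geometry is done over an arbitrary numeric field for a root basis with
    integral coordinates and a dual family of linear forms (based_roots), a notion
    which covers the simple Lie types and gl_n alike and which passes from the
    real vectors to the complex space h*. *)

Set Implicit Arguments.
Unset Strict Implicit.
Unset Printing Implicit Defensive.

Import Order.TTheory GRing.Theory Num.Theory.
Local Open Scope ring_scope.

(** * Alternating products and the Coxeter presentation *)

Section Alternating.
Variables (T : Type) (idx : T) (op : Monoid.law idx).
Implicit Types x y z : T.
Let opA x y z : op x (op y z) = op (op x y) z := Monoid.mulmA op x y z.

(** Growing on the right makes the k-th letter independent of the length; altS
    gives the recursion on the left. The operation is a parameter because the same
    words are compared in a group and in a ring. *)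
Fixpoint alt x y k : T :=
  if k is k'.+1 then op (alt x y k') (if odd k' then y else x) else idx.

Lemma altS x y k : alt x y k.+1 = op x (alt y x k).
Proof.
elim: k => [|k IH]; first by rewrite /= Monoid.mul1m Monoid.mulm1.
rewrite -[LHS]/(op (alt x y k.+1) (if odd k.+1 then y else x)) IH -opA.
by rewrite /=; case: (odd k).
Qed.

Lemma altD x y k l :
  alt x y (k + l) = op (alt x y k) (if odd k then alt y x l else alt x y l).
Proof.
elim: k x y => [|k IH] x y; first by rewrite /= Monoid.mul1m.
by rewrite addSn !altS IH opA /=; case: (odd k).
Qed.

Lemma alt_inv x y k : op x x = idx -> op y y = idx ->
  op (if odd k then alt x y k else alt y x k) (alt x y k) = idx.
Proof.
move=> x2 y2; elim: k x y x2 y2 => [|k IH] x y x2 y2.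
  by rewrite /= Monoid.mul1m.
rewrite [X in op _ X]altS /=.
have xxK z : op x (op x z) = z by rewrite opA x2 Monoid.mul1m.
by have := IH y x y2 x2; case: (odd k) => /= e; rewrite -opA xxK.
Qed.

(** The relation (x y)^m = 1 makes the two halves of the alternating word of
    length 2 m inverse to each other, and the inverse of an alternating word in
    involutions is the word read backwards, which alternates too. *)
Lemma alt_braid x y m : op x x = idx -> op y y = idx ->
  alt x y (m + m) = idx -> alt x y m = alt y x m.
Proof.
move=> x2 y2; rewrite altD => h; have := alt_inv m x2 y2.
move/(congr1 (fun z => op z (if odd m then alt y x m else alt x y m))).
by rewrite -opA h Monoid.mulm1 Monoid.mul1m; case: odd.
Qed.

Lemma alt_double x y k : alt x y (k.+1 + k.+1) = op (op x y) (alt x y (k + k)).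
Proof. by rewrite addSn addnS !altS opA. Qed.

End Alternating.

Lemma alt_mulg (gT : finGroupType) (x y : gT) k :
  alt mulg x y (k + k) = ((x * y) ^+ k)%g.
Proof. by elim: k => // k IH; rewrite alt_double IH expgS. Qed.

Lemma alt_mulr (M : pzRingType) (x y : M) k :
  alt *%R x y (k + k) = (x * y) ^+ k.
Proof. by elim: k => // k IH; rewrite alt_double IH exprS. Qed.

Lemma gen_ind (gT : finGroupType) (I : finType) (s : I -> gT) (P : gT -> Prop) :
  <<[set s i | i : I]>>%g = [set: gT] ->
  P 1%g -> (forall i w, P w -> P (s i * w)%g) -> forall w, P w.
Proof.
move=> gen P1 PS w; have: w \in <<[set s i | i : I]>>%g by rewrite gen inE.
case/gen_prodgP => k [c cs ->]; elim: k c cs => [|k IH] c cs.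
  by rewrite big_ord0.
rewrite big_ord_recl; have /imsetP[i _ ->] := cs ord0.
by apply/PS/IH => j; apply: cs.
Qed.

(** D i w stands for: i is a left descent of w, that is w^-1 sends the i-th simple
    root to a negative root; N bounds the number of successive removals of
    descents. The dihedral condition says that if i and j are both descents, then
    the two alternating words of length the order of s_i s_j can both be removed
    from the left of w, each letter being a descent when its turn comes. *)
Section Presentation.
Variables (W : finGroupType) (n : nat) (s : 'I_n -> W).
Variables (D : 'I_n -> W -> bool) (N : W -> nat).
Hypothesis s_gen : <<[set s i | i : 'I_n]>>%g = [set: W].
Hypothesis s_inv : forall i, (s i * s i = 1)%g.
Hypothesis D_id : forall i, D i 1%g = false.
Hypothesis D_flip : forall i w, D i (s i * w)%g = ~~ D i w.
Hypothesis D_drop : forall i w, D i w -> (N (s i * w)%g < N w)%N.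
Hypothesis D_dihedral : forall i j w, i != j -> D i w -> D j w ->
  forall k, (k < #[s i * s j]%g)%N ->
  D (if odd k then j else i) ((alt mulg (s i) (s j) k)^-1 * w)%g.

Variables (M : pzRingType) (g : 'I_n -> M).
Hypothesis g_rel : forall i j, (g i * g j) ^+ #[s i * s j]%g = 1.

(** The candidate for the morphism strips one chosen descent at a time; k is the
    fuel, and any k >= N w gives the same value. *)
Fixpoint lift_rec (k : nat) (w : W) : M :=
  if k is k'.+1 then
    if [pick i | D i w] is Some i then g i * lift_rec k' (s i * w)%g else 1
  else 1.
Definition lift_elt (w : W) : M := lift_rec (N w) w.

Lemma lift_rec_stable k w : (N w <= k)%N -> lift_rec k w = lift_elt w.
Proof.
rewrite /lift_elt.
elim/ltn_ind: k w => k IH w; case: k IH => [|k] IH; first by case: (N w).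
case E: (N w) => [|l] hl /=; case: pickP => [i Di|//].
  by have := D_drop Di; rewrite E.
have hN := D_drop Di; rewrite E ltnS in hN.
by rewrite (IH k) // 1?[in RHS](IH l) // (leq_trans hN).
Qed.

Lemma lift_elt_pick w : lift_elt w =
  if [pick i | D i w] is Some i then g i * lift_elt (s i * w)%g else 1.
Proof.
rewrite -(lift_rec_stable (leqnSn (N w))) /=; case: pickP => // i Di.
by rewrite lift_rec_stable // ltnW // D_drop.
Qed.

Let g_inv i : g i * g i = 1.
Proof. by have := g_rel i i; rewrite s_inv order1. Qed.

Let sV i : ((s i)^-1 = s i)%g.
Proof. by apply/eqP; rewrite eq_invg_mul; apply/eqP/s_inv. Qed.

Let alt_step p q k w :
  (s (if odd k then q else p) * ((alt mulg (s p) (s q) k)^-1 * w) =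
   (alt mulg (s p) (s q) k.+1)^-1 * w)%g.
Proof. by rewrite /= invMg mulgA; case: odd; rewrite sV. Qed.

(** Independence of the chosen descent, by induction on N w. If the choice is p
    and i is another descent, then by induction the value can be computed by
    removing the alternating word of length m (the order of s_i s_p) starting with
    either letter. These words are equal in W, and so are the corresponding
    products of the g's, by the braid relation. *)
Lemma lift_elt_descent i w : D i w -> lift_elt w = g i * lift_elt (s i * w)%g.
Proof.
have [b] := ubnP (N w); elim: b w i => // b IH w i hb Di.
have drop p q k : p != q -> D p w -> D q w -> (k < #[s p * s q]%g)%N ->
    (N ((alt mulg (s p) (s q) k.+1)^-1 * w)%g < N w)%N.
  move=> pq Dp Dq hk.
  have step l : (l < #[s p * s q]%g)%N ->
      (N ((alt mulg (s p) (s q) l.+1)^-1 * w)%g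
        < N ((alt mulg (s p) (s q) l)^-1 * w)%g)%N.
    by move=> hl; rewrite -alt_step; apply/D_drop/D_dihedral.
  elim: k hk => [|k IHk] hk.
    by apply: leq_trans (step _ hk) _; rewrite [alt _ _ _ 0]/= invg1 mul1g.
  by apply: ltn_trans (step _ hk) _; apply/IHk/ltnW.
have chain p q k : p != q -> D p w -> D q w -> (k < #[s p * s q]%g)%N ->
    g p * lift_elt (s p * w)%g =
    alt *%R (g p) (g q) k.+1 * lift_elt ((alt mulg (s p) (s q) k.+1)^-1 * w)%g.
  move=> pq Dp Dq; elim: k => [|k IHk] hk; first by rewrite /= mul1r mul1g sV.
  rewrite (IHk (ltnW hk)) (IH _ (if odd k.+1 then q else p)); last first.
  - exact: D_dihedral.
  - by apply: leq_trans (drop _ _ _ pq Dp Dq (ltnW hk)) _; rewrite -ltnS.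
  by rewrite alt_step mulrA /=; case: odd.
rewrite lift_elt_pick; case: pickP => [p Dp|/(_ i)]; last by rewrite Di.
have [->//|ip] := eqVneq i p.
have mE : #[s p * s i]%g = #[s i * s p]%g by rewrite -orderV invMg !sV.
have := chain i p #[s i * s p]%g.-1; rewrite ?prednK // => -> //.
have := chain p i #[s i * s p]%g.-1; rewrite ?prednK // 1?eq_sym ?mE // => -> //.
have braidW := alt_braid (s_inv i) (s_inv p)
  (etrans (alt_mulg _ _ _) (expg_order (s i * s p)%g)).
have braidM := alt_braid (g_inv i) (g_inv p) (etrans (alt_mulr _ _ _) (g_rel i p)).
by rewrite braidW braidM.
Qed.

Lemma lift_eltS i w : lift_elt (s i * w)%g = g i * lift_elt w.
Proof.
case Di: (D i w); first by rewrite (lift_elt_descent Di) mulrA g_inv mul1r.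
by rewrite (@lift_elt_descent i) ?D_flip ?Di // mulgA s_inv mul1g.
Qed.

(** As i is a descent of exactly one of w and s_i w, lift_elt_descent shows that
    left multiplication by s_i acts on values as multiplication by g_i, and
    multiplicativity follows because the s_i generate. *)
Lemma coxeter_presentation : exists F : W -> M,
  [/\ F 1%g = 1, forall v w, F (v * w)%g = F v * F w & forall i, F (s i) = g i].
Proof.
exists (fun w => lift_elt w).
have E : lift_elt 1%g = 1.
  by rewrite lift_elt_pick; case: pickP => // i; rewrite D_id.
split=> // [v w|i]; last by rewrite -[s i]mulg1 lift_eltS E mulr1.
move: v; apply: (gen_ind s_gen) => [|i v IH]; first by rewrite mul1g E mul1r.
by rewrite -mulgA !lift_eltS IH mulrA.
Qed.
End Presentation.

(** * Root bases, descents and the dihedral subgroups *)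

(** For d = 2 cos t this is sin (k t) / sin t: a Chebyshev polynomial of the
    second kind with its index shifted by one. *)
Fixpoint cheb (K : pzRingType) (d : K) (k : nat) : K :=
  if k is k'.+1 then
    if k' is k''.+1 then d * cheb d k' - cheb d k'' else 1
  else 0.

(** The behaviour of cheb at d = 2 cos (pi / m), for the crystallographic m: it
    is positive on 1, ..., m - 1, and vanishes at m where it changes sign. *)
Record cheb_period (K : numFieldType) (d : K) (m : nat) : Prop := ChebPeriod {
  cheb_mem : m \in [:: 2; 3; 4; 6]%N;
  cheb_gt0 : forall k, (0 < k < m)%N -> 0 < cheb d k;
  cheb_m : cheb d m = 0;
  cheb_Sm : cheb d m.+1 = -1
}.

Lemma cheb_crystallographic (K : numFieldType) (d : K) (a : nat) :
  0 <= d -> d ^+ 2 = a%:R -> (a < 4)%N -> exists m, cheb_period d m.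
Proof.
move=> d0 dE a4.
have dd : d * d = a%:R by rewrite -expr2.
case: a a4 dE dd => [|[|[|[|//]]]] _ dE dd.
- exists 2%N; have d_0 : d = 0 by apply/eqP; rewrite -sqrf_eq0 dE.
  split=> //; rewrite /= ?d_0 ?mul0r ?subr0 ?sub0r //.
  by case=> [|[|k]].
- have d1 : d = 1 by apply/eqP; rewrite -(@eqrXn2 _ 2) // dE expr1n.
  exists 3%N; split=> //; rewrite /= ?d1; try ring.
  by case=> [|[|[|k]]] //= _; rewrite mulr1 subr0.
- have dp : 0 < d by rewrite lt0r d0 andbT -sqrf_eq0 dE pnatr_eq0.
  exists 4%N; split=> //=; rewrite ?mulr1 ?subr0 ?dd; try by ring: dd.
  case=> [|[|[|[|k]]]] //= _; rewrite ?mulr1 ?subr0 ?dd //.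
  by rewrite [_ - _](_ : _ = 1) //; ring.
- have dp : 0 < d by rewrite lt0r d0 andbT -sqrf_eq0 dE pnatr_eq0.
  exists 6%N; split=> //=; rewrite ?mulr1 ?subr0 ?dd; try by ring: dd.
  case=> [|[|[|[|[|[|k]]]]]] //= _; rewrite ?mulr1 ?subr0 ?dd //.
  + by rewrite [_ - _](_ : _ = 2) ?ltr0n //; ring.
  + by rewrite [_ - _](_ : _ = d) //; ring.
  + by rewrite [_ - _](_ : _ = 1) ?ltr01 //; ring: dd.
Qed.

Lemma cheb_shift (K : numFieldType) (d : K) m k :
  cheb_period d m -> cheb d (m + k) = - cheb d k.
Proof.
case=> _ _ m0 m1.
suff [//] : cheb d (m + k) = - cheb d k /\ cheb d (m + k.+1) = - cheb d k.+1.
elim: k => [|k [IH IH']]; first by rewrite addn0 addn1 m0 m1 oppr0.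
split=> //; rewrite addnS addnS; rewrite addnS in IH'.
rewrite [LHS]/(d * cheb d (m + k).+1 - cheb d (m + k)) IH IH'.
by rewrite -[cheb d k.+2]/(d * cheb d k.+1 - cheb d k) mulrN opprB opprK addrC.
Qed.

Section Roots.
Variables (K : numFieldType) (V : lmodType K) (form : V -> V -> K) (n : nat).
Variables (beta : 'I_n -> V).

Definition refl i v : V := v - form v (beta i) *: beta i.

(** A reduced set of roots with simple roots r_i beta_i, given with the dual
    family u of linear forms. Natural coordinates in br_base carry the
    crystallographic condition: the Cartan integers are coordinates of reflected
    simple roots (obtuse_simple). Stating freeness through u, and positivity
    through r_i and the coordinates, keeps the notion meaningful over a field that
    is only partially ordered. *)
Record based_roots (Phi : seq V) (r : 'I_n -> K) (u : 'I_n -> {scalar V}) :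
    Prop := BasedRoots {
  br_scale : forall i, 0 < r i;
  br_simple : forall i, r i *: beta i \in Phi;
  br_neq0 : 0 \notin Phi;
  br_refl : forall i a, a \in Phi -> refl i a \in Phi;
  br_reduced : forall i k, k *: (r i *: beta i) \in Phi -> k = 1 \/ k = -1;
  br_base : forall a, a \in Phi -> exists c : 'I_n -> nat,
    a = \sum_i (c i)%:R *: (r i *: beta i) \/
    a = - \sum_i (c i)%:R *: (r i *: beta i);
  br_dual : forall i j, u i (r j *: beta j) = (i == j)%:R;
  br_acute : forall i j, i != j -> form (beta i) (beta j) ^+ 2 < 4
}.

Hypothesis formDl : forall a b c, form (a + b) c = form a c + form b c.
Hypothesis formZl : forall k a b, form (k *: a) b = k * form a b.
Hypothesis formC : forall a b, form a b = form b a.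
Hypothesis form_beta : forall i, form (beta i) (beta i) = 2.

Variables (Phi : seq V) (r : 'I_n -> K) (u : 'I_n -> {scalar V}).
Hypothesis rootsP : based_roots Phi r u.
Let alpha i : V := r i *: beta i.
Let rV_neq0 i : r i != 0. Proof. by rewrite gt_eqF // (br_scale rootsP). Qed.

Let dualE i j : u i (alpha j) = (i == j)%:R. Proof. exact: br_dual rootsP i j. Qed.
Let simpleP i : alpha i \in Phi. Proof. exact: br_simple rootsP i. Qed.

Lemma dual_sum i (c : 'I_n -> K) : u i (\sum_j c j *: alpha j) = c i.
Proof.
rewrite linear_sum (bigD1 i) //= linearZ /= dualE eqxx mulr1.
rewrite big1 ?addr0 // => j /negPf ji.
by rewrite linearZ /= dualE eq_sym ji mulr0.
Qed.

Lemma refl_alpha i a : refl i a = a - (form a (beta i) / r i) *: alpha i.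
Proof. by rewrite /refl /alpha scalerA divfK. Qed.

Let dualB j v k i : u j (v - k *: alpha i) = u j v - k * (j == i)%:R.
Proof. by rewrite linearB [u j (k *: _)]linearZ /= dualE. Qed.

(** Reflecting the i-th simple root in the j-th one gives a root whose i-th
    coordinate is 1, so its j-th coordinate is a natural number too. *)
Lemma obtuse_simple i j : i != j ->
  exists c : nat, - form (beta i) (beta j) * r i / r j = c%:R.
Proof.
move=> ij; have [c] := br_base rootsP (br_refl rootsP j (simpleP i)).
rewrite refl_alpha [form (alpha i) _]formZl.
case=> /[dup] /(congr1 (u i)) ei /(congr1 (u j)) ej.
  exists (c j); move: ej; rewrite dual_sum => <-.
  rewrite dualB dualE eqxx eq_sym (negPf ij) sub0r.
  by rewrite mulr1 !mulNr [r i * _]mulrC.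
move: ei; rewrite linearN dual_sum dualB dualE eqxx (negPf ij).
rewrite mulr0 subr0 => e; have: (0 : K) < - (c i)%:R by rewrite -e ltr01.
by rewrite oppr_gt0 ltrn0.
Qed.

(** The square of (beta_i, beta_j) is the product of two opposite Cartan integers,
    hence a natural number, and it is smaller than 4. *)
Lemma bond_period i j : i != j ->
  exists m, cheb_period (- form (beta i) (beta j)) m.
Proof.
move=> ij; have [a ea] := obtuse_simple ij.
have ji : j != i by rewrite eq_sym.
have [b] := obtuse_simple ji; rewrite formC => eb.
have dE : (- form (beta i) (beta j)) ^+ 2 = (a * b)%:R.
  by rewrite natrM -ea -eb; field; rewrite !rV_neq0.
apply: (cheb_crystallographic _ dE); last first.
  by have := br_acute rootsP ij; rewrite -sqrrN dE ltr_nat.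
have -> : - form (beta i) (beta j) = a%:R * (r j / r i).
  by rewrite -ea; field; rewrite !rV_neq0.
by rewrite mulr_ge0 ?ler0n // divr_ge0 // ltW // (br_scale rootsP).
Qed.

(** The height: on roots, its sign tells positive roots from negative ones. *)
Definition ht (v : V) : K := \sum_i u i v.

Lemma htN v : ht (- v) = - ht v.
Proof. by rewrite /ht -sumrN; apply: eq_bigr => i _; rewrite linearN. Qed.
Lemma htD v w : ht (v + w) = ht v + ht w.
Proof. by rewrite /ht -big_split; apply: eq_bigr => i _; rewrite linearD. Qed.
Lemma htZ k v : ht (k *: v) = k * ht v.
Proof. by rewrite /ht mulr_sumr; apply: eq_bigr => i _; rewrite linearZ. Qed.

Lemma ht_base (c : 'I_n -> nat) :
  ht (\sum_i (c i)%:R *: alpha i) = (\sum_i c i)%:R.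
Proof. by rewrite natr_sum; apply: eq_bigr => i _; rewrite dual_sum. Qed.

Lemma ht_alpha i : ht (alpha i) = 1.
Proof.
rewrite /ht (bigD1 i) //= dualE eqxx big1 ?addr0 // => j ji.
by rewrite dualE (negPf ji).
Qed.

Lemma root_sign a : a \in Phi -> (0 < ht a) || (ht a < 0).
Proof.
move=> aP; have [c ac] := br_base rootsP aP.
have a0 : a != 0 by apply: contraTneq aP => ->; apply: br_neq0 rootsP.
have h : (0 < \sum_i c i)%N.
  rewrite lt0n; apply: contraNneq a0 => /eqP; rewrite sum_nat_eq0 => /forallP c0.
  case: ac => ->; rewrite ?oppr_eq0 big1 // => i _;
    by have /eqP -> := c0 i; rewrite scale0r.
by case: ac => ->; rewrite ?htN ht_base ?oppr_lt0 ltr0n h ?orbT.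
Qed.

(** A positive root other than the i-th simple root has a positive coordinate
    away from i, for otherwise it would be a multiple of that root; the reflection
    does not change this coordinate. *)
Lemma refl_pos i a :
  a \in Phi -> 0 < ht a -> a != alpha i -> 0 < ht (refl i a).
Proof.
move=> aP a0; have sP := br_refl rootsP i aP.
have [//|/= s0] := orP (root_sign sP).
have [c [ac|ac]] := br_base rootsP aP; last first.
  by move: a0; rewrite ac htN ht_base oppr_gt0 ltrn0.
have [c' [sc|sc]] := br_base rootsP sP.
  by move: s0; rewrite sc ht_base ltrn0.
have cj j : j != i -> c j = 0%N.
  move=> ji; have := congr1 (u j) sc; rewrite linearN dual_sum refl_alpha dualB.
  rewrite (negPf ji) mulr0 subr0 ac dual_sum.
  move/eqP; rewrite -addr_eq0 -natrD pnatr_eq0 addn_eq0 => /andP[/eqP//].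
have ai : a = (c i)%:R *: alpha i.
  by rewrite ac (bigD1 i) //= big1 ?addr0 // => j /cj ->; rewrite scale0r.
have := aP; rewrite {1}ai => /(br_reduced rootsP)[c1|c1].
  by rewrite ai c1 scale1r eqxx.
by have := ler0n K (c i); rewrite c1 oppr_ge0 ler10.
Qed.

Lemma reflD i v w : refl i (v + w) = refl i v + refl i w.
Proof. by rewrite /refl formDl scalerDl opprD addrACA. Qed.
Lemma reflZ i k v : refl i (k *: v) = k *: refl i v.
Proof. by rewrite /refl formZl scalerBr scalerA. Qed.
Lemma refl_beta i : refl i (beta i) = - beta i.
Proof. by rewrite /refl form_beta scaler_nat mulr2n opprD addNKr. Qed.
Lemma reflK i : involutive (refl i).
Proof.
move=> v; rewrite {1}/refl.
have -> : form (refl i v) (beta i) = - form v (beta i).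
  by rewrite /refl -scaleNr formDl formZl form_beta; ring.
by rewrite scaleNr opprK /refl subrK.
Qed.

Section Action.
Variables (W : finGroupType) (s : 'I_n -> W) (act : W -> {linear V -> V}).
Hypothesis s_gen : <<[set s i | i : 'I_n]>>%g = [set: W].
Hypothesis act1 : forall v, act 1%g v = v.
Hypothesis actM : forall w w' v, act (w * w')%g v = act w (act w' v).
Hypothesis act_inj : forall w w', act w =1 act w' -> w = w'.
Hypothesis act_s : forall i v, act (s i) v = refl i v.

Lemma act_root w a : a \in Phi -> act w a \in Phi.
Proof.
move=> aP; move: w; apply: (gen_ind s_gen) => [|i w IH]; first by rewrite act1.
by rewrite actM act_s (br_refl rootsP).
Qed.

Lemma s_inv i : (s i * s i = 1)%g.
Proof. by apply: act_inj => v; rewrite actM !act_s act1 reflK. Qed.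

Let sV i : ((s i)^-1 = s i)%g.
Proof. by apply/eqP; rewrite eq_invg_mul; apply/eqP/s_inv. Qed.

(** Testing beta_i amounts to testing the simple root, as r_i > 0. *)
Definition descent i w : bool := ht (act w^-1%g (beta i)) < 0.
Definition inversions w : nat :=
  count (fun a => (0 < ht a) && (ht (act w^-1%g a) < 0)) (undup Phi).

Lemma ht_act_beta i w :
  (0 < ht (act w (beta i))) || (ht (act w (beta i)) < 0).
Proof.
have := root_sign (act_root w (simpleP i)).
by rewrite linearZ htZ pmulr_rgt0 ?pmulr_rlt0 ?(br_scale rootsP).
Qed.

Lemma descent1 i : descent i 1%g = false.
Proof.
apply/negbTE; rewrite /descent invg1 act1.
have := ht_alpha i; rewrite /alpha htZ => h.
have : 0 < r i * ht (beta i) by rewrite h ltr01.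
by rewrite pmulr_rgt0 ?(br_scale rootsP) // => /lt_gtF ->.
Qed.

Lemma descent_flip i w : descent i (s i * w)%g = ~~ descent i w.
Proof.
rewrite /descent invMg actM sV act_s refl_beta linearN htN oppr_lt0.
by case/orP: (ht_act_beta i w^-1%g) => h; rewrite h (lt_gtF h).
Qed.

(** The reflection in the i-th simple root maps the inversions of s_i w injectively
    to inversions of w other than that root, which is itself an inversion of w. *)
Lemma descent_inversions i w :
  descent i w -> (inversions (s i * w)%g < inversions w)%N.
Proof.
move=> Di; rewrite /inversions -!size_filter.
set P' := [seq a <- _ | _]; set P := [seq a <- _ | _].
have P'E a : a \in P' -> [/\ a \in Phi, 0 < ht a,
    ht (act w^-1%g (refl i a)) < 0 & a != alpha i].
  rewrite mem_filter mem_undup invMg actM sV act_s => /andP[/andP[a0 wa] aP].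
  split=> //; apply: contraL wa => /eqP ->.
  rewrite reflZ refl_beta linearZ linearN htZ htN pmulr_rlt0 ?(br_scale rootsP) //.
  by rewrite oppr_lt0 lt_gtF.
have uP' : uniq (alpha i :: map (refl i) P').
  rewrite /= (map_inj_uniq (inv_inj (reflK i))) (filter_uniq _ (undup_uniq _)) andbT.
  apply/mapP => -[a /P'E[_ a0 _ _]] /(congr1 (refl i)); rewrite reflK => ea.
  move: a0; rewrite -ea reflZ refl_beta scalerN htN -/(alpha i) ht_alpha.
  by rewrite oppr_gt0 ltr10.
have := uniq_leq_size uP'; rewrite /= size_map; apply=> b.
rewrite inE mem_filter mem_undup => /predU1P[->|/mapP[a /P'E[aP a0 wa na] ->]].
  rewrite ht_alpha ltr01 simpleP linearZ htZ.
  rewrite pmulr_rlt0 ?(br_scale rootsP) //.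
  by rewrite andbT.
by rewrite refl_pos // wa (br_refl rootsP).
Qed.

(** The roots of the dihedral subsystem, listed by alternating reflections of a
    simple root. *)
Lemma alt_beta i j k :
  act (alt mulg (s i) (s j) k) (beta (if odd k then j else i)) =
  cheb (- form (beta i) (beta j)) k.+1 *: beta i +
  cheb (- form (beta i) (beta j)) k *: beta j.
Proof.
elim: k i j => [|k IH] i j; first by rewrite act1 scale1r scale0r addr0.
have -> : (if odd k.+1 then j else i) = if odd k then i else j.
  by rewrite /=; case: odd.
rewrite altS actM IH act_s reflD !reflZ refl_beta /= [form (beta j) _]formC.
set d := - _; have -> : refl i (beta j) = beta j + d *: beta i.
  by rewrite /refl formC -scaleNr.
by rewrite scalerDr scalerA scalerN [_ * d]mulrC scalerBl -addrA addrC.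
Qed.

Lemma dual_beta i j x y : i != j ->
  u i (x *: beta i + y *: beta j) = x / r i.
Proof.
move=> ij; have E k l z : u k (z *: beta l) = z / r l * (k == l)%:R.
  by rewrite -dualE -linearZ /= /alpha scalerA divfK.
by rewrite linearD !E eqxx (negPf ij) mulr0 addr0 mulr1.
Qed.

Let coordI i j x y x' y' : i != j ->
  x *: beta i + y *: beta j = x' *: beta i + y' *: beta j -> x = x'.
Proof.
move=> ij /(congr1 (u i)); rewrite !dual_beta //.
by apply: mulIf; rewrite invr_eq0.
Qed.

Lemma rot_beta i j k :
  act ((s i * s j) ^+ k)%g (beta i) =
  cheb (- form (beta i) (beta j)) (k + k).+1 *: beta i +
  cheb (- form (beta i) (beta j)) (k + k) *: beta j.
Proof. by rewrite -alt_mulg -alt_beta addnn odd_double. Qed.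

Lemma rot_fix_beta i j m : cheb_period (- form (beta i) (beta j)) m ->
  act ((s i * s j) ^+ m)%g (beta i) = beta i.
Proof.
move=> per; rewrite rot_beta -addnS !(cheb_shift _ per).
by rewrite (cheb_Sm per) (cheb_m per) opprK oppr0 scale1r scale0r addr0.
Qed.

(** The rotation s_i s_j has period m on beta_i and beta_j by alt_beta. As
    d^2 < 4 the form is nondegenerate on their span, and a vector v splits into a
    part in the span and a part orthogonal to it, which s_i and s_j fix. *)
Lemma rot_period i j m : i != j ->
  cheb_period (- form (beta i) (beta j)) m -> ((s i * s j) ^+ m = 1)%g.
Proof.
move=> ij per; set d := - _ in per.
have rot_i := rot_fix_beta per.
have rot_j : act ((s i * s j) ^+ m)%g (beta j) = beta j.
  rewrite -{1}(@rot_fix_beta j i m); last by rewrite formC.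
  rewrite -actM -[(s j * s i)%g]invgK invMg !sV expgVn mulgV; exact: act1.
have d4 : 4 - d ^+ 2 != 0.
  by rewrite subr_eq0 eq_sym lt_eqF // sqrrN (br_acute rootsP ij).
apply: act_inj => v; rewrite act1.
set p := form v (beta i); set q := form v (beta j).
(* x and y are the coordinates of the orthogonal projection of v to the span: the
   Gram matrix with entries 2 and -d, of determinant 4 - d^2, has been inverted. *)
pose x := (2 * p + d * q) / (4 - d ^+ 2); pose y := (d * p + 2 * q) / (4 - d ^+ 2).
pose v0 := v - (x *: beta i + y *: beta j).
have fv0 k : form v0 (beta k) =
    form v (beta k) - (x * form (beta i) (beta k) + y * form (beta j) (beta k)).
  by rewrite /v0 -scaleN1r formDl formZl formDl !formZl mulN1r.
have fji : form (beta j) (beta i) = - d by rewrite formC opprK.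
have fij : form (beta i) (beta j) = - d by rewrite opprK.
have v0i : act (s i) v0 = v0.
  rewrite act_s /refl fv0 form_beta fji -/p [X in X *: _](_ : _ = 0) ?scale0r ?subr0 //.
  by rewrite /x /y; field.
have v0j : act (s j) v0 = v0.
  rewrite act_s /refl fv0 form_beta fij -/q [X in X *: _](_ : _ = 0) ?scale0r ?subr0 //.
  by rewrite /x /y; field.
have v0m k : act ((s i * s j) ^+ k)%g v0 = v0.
  by elim: k => [|k IH]; rewrite ?act1 // expgS !actM IH v0j v0i.
have vE : v = v0 + (x *: beta i + y *: beta j) by rewrite /v0 subrK.
clearbody v0; rewrite vE.
by rewrite !linearD !linearZ v0m rot_i rot_j.
Qed.

(** A smaller order k would make (s_i s_j)^k fix beta_i, so that cheb takes the
    value 1 at 2 k + 1 and 0 at 2 k. But 0 < 2 k < 2 m, where cheb vanishes only at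
    m, and there the next value is -1. *)
Lemma bond_order i j m : i != j ->
  cheb_period (- form (beta i) (beta j)) m -> #[s i * s j]%g = m.
Proof.
move=> ij per; have m1 := rot_period ij per; set d := - _ in per.
have m0 : (0 < m)%N by have := cheb_mem per; rewrite !inE => /or4P[]/eqP->.
have ord_le : (#[s i * s j]%g <= m)%N by rewrite dvdn_leq // order_dvdn m1.
apply/eqP; rewrite eqn_leq ord_le /= leqNgt; apply/negP => om.
set k := #[_]%g in om; have k0 : (0 < k)%N by exact: order_gt0.
have := rot_beta i j k; rewrite expg_order act1 -/d.
rewrite -[LHS]addr0 -[X in X + 0]scale1r -(scale0r (beta j)) => E.
have e1 := coordI ij E; rewrite addrC [RHS]addrC in E.
have := @coordI j i _ _ _ _ _ E; rewrite eq_sym => /(_ ij) e0.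
have [km|km|km] := ltngtP (k + k)%N m.
- by have := cheb_gt0 per (k := k + k); rewrite km addn_gt0 k0 -e0 ltxx => /(_ isT).
- have e : (k + k = m + (k + k - m))%N by rewrite subnKC // ltnW.
  have := cheb_gt0 per (k := k + k - m).
  rewrite subn_gt0 km (ltn_subLR _ (ltnW km)) !addnn ltn_double om => /(_ isT).
  by rewrite -oppr_lt0 -(cheb_shift _ per) -addnn -e -e0 ltxx.
- move/eqP: e1; rewrite km (cheb_Sm per) -subr_eq0 opprK.
  by rewrite -(natrD _ 1 1) pnatr_eq0.
Qed.

(** The k-th letter is a descent because w^-1 is applied to a combination of
    beta_i and beta_j with coefficients nonnegative and not both zero. *)
Lemma descent_dihedral i j w : i != j -> descent i w -> descent j w ->
  forall k, (k < #[s i * s j]%g)%N ->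
  descent (if odd k then j else i) ((alt mulg (s i) (s j) k)^-1 * w)%g.
Proof.
move=> ij Di Dj k km; have [m per] := bond_period ij.
rewrite (bond_order ij per) in km.
rewrite /descent invMg invgK actM alt_beta linearD !linearZ htD !htZ.
case: k km => [|k] km; first by rewrite mul1r mul0r addr0.
have lt0 : cheb (- form (beta i) (beta j)) k.+1 * ht (act w^-1%g (beta j)) < 0.
  by rewrite pmulr_rlt0 // (cheb_gt0 per).
have [mk|mk] := ltnP k.+2 m.
  by rewrite ltr_wnDl // nmulr_lle0 // ltW // (cheb_gt0 per).
have -> : k.+2 = m by apply/eqP; rewrite eqn_leq km.
by rewrite (cheb_m per) mul0r add0r.
Qed.

Theorem reflection_presentation (M : pzRingType) (g : 'I_n -> M) :
  (forall i j, (g i * g j) ^+ #[s i * s j]%g = 1) ->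
  exists F : W -> M,
  [/\ F 1%g = 1, forall v w, F (v * w)%g = F v * F w & forall i, F (s i) = g i].
Proof.
exact: (coxeter_presentation s_gen s_inv descent1 descent_flip
          descent_inversions descent_dihedral).
Qed.

End Action.
End Roots.

(** * Morphisms of presented superalgebras and Clifford vectors *)

Section Morphisms.
Variables (F : fieldType) (P : presentation F) (A B : superalgType F).

Lemma teval_pgenerator (t : term F (pgen P)) :
  teval (A := palg P) (@pgenerator F P) t = pclass t.
Proof. by elim: t => //= t -> u ->; rewrite ?pclass_Add ?pclass_Mul. Qed.

Lemma prel_eq (t u : term F (pgen P)) : prel t u ->
  teval (A := palg P) (@pgenerator F P) t = teval (A := palg P) (@pgenerator F P) u.
Proof. by move=> tu; rewrite !teval_pgenerator; apply/pclassP/teq_rel. Qed.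

Lemma teval_morphism G (f : A -> B) (h : G -> A) (t : term F G) :
  superalg_morphism f -> teval (fun x => f (h x)) t = f (teval h t).
Proof.
case=> fc fD fM _; elim: t => [g|k|t IHt u IHu|t IHt u IHu] //=.
  by rewrite IHt IHu fD.
by rewrite IHt IHu fM.
Qed.

Lemma eq_teval G (f h : G -> A) (t : term F G) : f =1 h -> teval f t = teval h t.
Proof. by move=> fh; elim: t => //= t -> u ->. Qed.

Lemma teval_tmap_comp G H (f : H -> A) (h : G -> H) (t : term F G) :
  teval f (tmap h t) = teval (fun x => f (h x)) t.
Proof. by elim: t => //= t -> u ->. Qed.

Lemma teval_texp G (h : G -> A) (t : term F G) k :
  teval h (texp t k) = teval h t ^+ k.
Proof. by elim: k => [|k IH] /=; [exact: scst1 | rewrite exprS -IH]. Qed.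

End Morphisms.

Section MorphismExt.
Variables (F : fieldType) (P : presentation F) (A : superalgType F).

(** This uniqueness is how equalities between composed maps are reduced to
    generators below. *)
Lemma palg_morphism_ext (f g : palg P -> A) :
  superalg_morphism f -> superalg_morphism g ->
  (forall x, f (pgenerator x) = g (pgenerator x)) -> f =1 g.
Proof.
move=> fM gM fg; elim/pclass_ind => t; rewrite -teval_pgenerator.
by rewrite -(teval_morphism _ _ fM) -(teval_morphism _ _ gM); apply: eq_teval.
Qed.

Lemma superalg_morphism_id : superalg_morphism (@id A).
Proof. by []. Qed.

End MorphismExt.

Lemma smorph1 (F : fieldType) (A B : superalgType F) (f : A -> B) :
  superalg_morphism f -> f 1 = 1.
Proof. by case=> fc _ _ _; rewrite -(scst1 (s := A)) fc scst1. Qed.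

Lemma smorphX (F : fieldType) (A B : superalgType F) (f : A -> B) x k :
  superalg_morphism f -> f (x ^+ k) = f x ^+ k.
Proof.
move=> fM; elim: k => [|k IH]; first exact: smorph1.
by rewrite !exprS -IH; case: fM.
Qed.

Lemma superalg_morphism_comp (F : fieldType) (A B C : superalgType F)
    (g : B -> C) (f : A -> B) :
  superalg_morphism g -> superalg_morphism f -> superalg_morphism (fun x => g (f x)).
Proof.
case=> gc gD gM gh [fc fD fM fh]; split=> [k|x y|x y|p x hx].
- by rewrite fc gc.
- by rewrite fD gD.
- by rewrite fM gM.
- exact/gh/fh.
Qed.

(** The Clifford relations are used both in the Clifford algebra and in the smash
    product, hence for an arbitrary map f from vectors. *)
Section CliffordMap.
Variables (K : numFieldType) (V : lmodType K) (form : V -> V -> K).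
Variables (A : superalgType K) (f : V -> A).
Hypothesis fL : forall k a b, f (k *: a + b) = scst k * f a + f b.
Hypothesis fC : forall a b, f a * f b + f b * f a = scst (form a b).

Lemma cliff0 : f 0 = 0.
Proof.
by have := fL 1 0 0; rewrite scaler0 addr0 scst1 mul1r => /(congr1 (+%R^~ (- f 0)));
  rewrite addrK subrr.
Qed.

Lemma cliffB a k b : f (a - k *: b) = f a - scst k * f b.
Proof. by rewrite -scaleNr addrC fL scstN mulNr addrC. Qed.

Lemma cliff_sq a : form a a = 2 -> f a * f a = 1.
Proof.
move=> a2; have := fC a a; rewrite a2 => /(congr1 (fun x => scst 2^-1 * x)).
rewrite -scstM mulVf ?pnatr_eq0 // scst1 mulrDr -mulrDl -scstD.
by rewrite [_ + _](_ : _ = 1) ?scst1 ?mul1r //; field.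
Qed.

(** Conjugation by a vector b with (b, b) = 2 is minus the reflection in b. *)
Lemma cliff_reflection a b : form b b = 2 ->
  f (a - form a b *: b) * f b = - (f b * f a).
Proof.
move=> b2; rewrite cliffB mulrBl -mulrA (cliff_sq b2) mulr1 -fC.
by rewrite opprD addrA subrr sub0r.
Qed.

Lemma cheb_expr (d : K) (z : A) k : z * z = scst d * z - 1 ->
  z ^+ k.+1 = scst (cheb d k.+1) * z - scst (cheb d k).
Proof.
move=> zz; elim: k => [|k IH]; first by rewrite expr1 scst1 scst0 mul1r subr0.
rewrite exprSr IH -[cheb d k.+2]/(d * cheb d k.+1 - cheb d k).
rewrite mulrBl -mulrA zz mulrBr mulr1 mulrA -scstM [_ * d]mulrC.
by rewrite scstD scstN mulrDl mulNr addrAC.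
Qed.

Lemma cheb_expr_period (d : K) (z : A) m : cheb_period d m ->
  z * z = scst d * z - 1 -> z ^+ m = -1.
Proof.
case=> mem _; case: m mem => // k _ cm cSm /cheb_expr ->.
have ck : cheb d k = 1.
  by move: cSm; rewrite -[LHS]/(d * cheb d k.+1 - cheb d k) cm mulr0 sub0r => /oppr_inj.
by rewrite cm ck scst0 scst1 mul0r sub0r.
Qed.

(** The element z = - f a f b is a root of z^2 = d z - 1 with d = - (a, b), so
    that z^m = -1 by cheb_expr_period. *)
Lemma cliff_mul_period a b m : form a a = 2 -> form b b = 2 ->
  cheb_period (- form a b) m -> (f a * f b) ^+ m = - (-1) ^+ m.
Proof.
move=> /cliff_sq a2 /cliff_sq b2 per; rewrite -[f a * f b]opprK [LHS]exprNn.
rewrite (@cheb_expr_period _ (- (f a * f b)) _ per) ?mulrN1 // mulrNN.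
have ba : f b * f a = scst (form a b) - f a * f b by rewrite -fC addrC addKr.
rewrite mulrA -[f a * f b * f a]mulrA ba mulrBr -scstC mulrBl -!mulrA b2 mulr1.
by rewrite a2 scstN mulNr mulrN opprK.
Qed.

End CliffordMap.

(** * The isomorphism for a reflection group with Coxeter presentation *)

Section TensorGroupAlgebra.
Variables (K : fieldType) (A : superalgType K) (W : finGroupType).
Notation T := (tensor A (galg K W)).

Lemma galg_even (f : galg K W) : homog false f. Proof. by []. Qed.

Lemma geltM (v w : W) : gelt K v * gelt K w = gelt K (v * w)%g.
Proof.
apply/ffunP => x; rewrite /GRing.mul /= !ffunE (bigD1 v) //= !ffunE eqxx mul1r.
rewrite big1 ?addr0 => [|y /negPf yv]; last by rewrite !ffunE yv mul0r.
by rewrite -(inj_eq (mulgI v)) mulKVg.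
Qed.

Lemma gelt_sum (f : galg K W) : f = \sum_w scst (f w) * gelt K w.
Proof.
apply/ffunP => x; rewrite sum_ffunE (bigD1 x) //= [X in X + _]gmul_cst ffunE eqxx mulr1.
rewrite big1 ?addr0 // => w /negPf wx.
by rewrite [LHS]gmul_cst ffunE eq_sym wx mulr0.
Qed.

(** No sign appears since the group algebra is purely even. *)
Lemma tensM_even (a a' : A) (f f' : galg K W) :
  tens a f * tens a' f' = tens (a * a') (f * f') :> T.
Proof.
rewrite -[a']spart_sum mulrDr !tensDl mulrDr.
by congr (_ + _); rewrite (tensM _ _ (galg_even f) (homog_spart _ _)) mul1r.
Qed.

Lemma tensX_even (a : A) (f : galg K W) k :
  tens a f ^+ k = tens (a ^+ k) (f ^+ k) :> T.
Proof. by elim: k => // k IH; rewrite !exprS IH tensM_even. Qed.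

Lemma geltX (w : W) k : gelt K w ^+ k = gelt K (w ^+ k)%g.
Proof. by elim: k => // k IH; rewrite exprS IH geltM expgS. Qed.

Lemma tens_homog p (a : A) (f : galg K W) : homog p a -> homog p (tens a f : T).
Proof.
move=> ha; rewrite /homog [LHS](tens_part_homog _ ha (galg_even f)).
by rewrite addbF eqxx.
Qed.

Lemma tens_l_morphism : superalg_morphism (fun a : A => tens a 1 : T).
Proof.
split=> // [x y|x y|p x]; first exact: tensDl; last exact: tens_homog.
by rewrite tensM_even mulr1.
Qed.

Lemma tens_sum (a : A) I (r : seq I) (f : I -> galg K W) :
  tens a (\sum_(i <- r) f i) = \sum_(i <- r) tens a (f i) :> T.
Proof.
by elim/big_rec2: _ => [|i x y _ <-]; rewrite ?tens0r ?tensDr.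
Qed.

End TensorGroupAlgebra.

(** The reflection group enters through four facts: the s_i generate W and satisfy
    the Coxeter relations, these present W, and each exponent m i j is the cheb
    period of the corresponding pair of vectors. *)
Section Iso.
Variables (K : numFieldType) (V : lmodType K) (form : V -> V -> K) (n : nat).
Variables (beta : 'I_n -> V) (m : 'I_n -> 'I_n -> nat).
Variables (W : finGroupType) (s : 'I_n -> W) (sigma : 'I_n -> V -> V).
Hypothesis form_beta : forall i, form (beta i) (beta i) = 2.
Hypothesis sigmaE : forall i a, sigma i a = a - form a (beta i) *: beta i.
Hypothesis m_diag : forall i, m i i = 1%N.
Hypothesis m_sym : forall i j, m i j = m j i.
Hypothesis m_period :
  forall i j, i != j -> cheb_period (- form (beta i) (beta j)) (m i j).
Hypothesis s_gen : <<[set s i | i : 'I_n]>>%g = [set: W].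
Hypothesis s_rel : forall i j, ((s i * s j) ^+ m i j = 1)%g.
Hypothesis s_pres : forall (M : pzRingType) (g : 'I_n -> M),
  (forall i j, (g i * g j) ^+ m i j = 1) -> exists F : W -> M,
  [/\ F 1%g = 1, forall v w, F (v * w)%g = F v * F w & forall i, F (s i) = g i].

Notation C := (clifford form).
Notation S := (smash form m sigma).
Notation T := (tensor C (galg K W)).
Notation xi := (cvec form).

Lemma cvecL k a b : xi (k *: a + b) = scst k * xi a + xi b.
Proof. exact: (@prel_eq _ (clifford_pres form) _ _ (clifford_linear form k a b)). Qed.
Lemma cvecC a b : xi a * xi b + xi b * xi a = scst (form a b).
Proof. exact: (@prel_eq _ (clifford_pres form) _ _ (clifford_anticomm form a b)). Qed.

(** The value prescribed for (t_i t_j)^m. *)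
Definition coxeter_sign (i j : 'I_n) : K := if m i j \in [:: 1; 3]%N then 1 else -1.

Lemma coxeter_signE i j :
  (m i j \in [:: 1; 3]%N) || (m i j \in [:: 2; 4; 6]%N).
Proof.
have [->|ij] := eqVneq i j; first by rewrite m_diag.
by have := cheb_mem (m_period ij); rewrite !inE => /or4P[] /eqP ->.
Qed.

(** The products beta_i beta_j obey the same relations as the t_i t_j. *)
Lemma cliff_mul_order (A : superalgType K) (f : V -> A) :
  (forall k a b, f (k *: a + b) = scst k * f a + f b) ->
  (forall a b, f a * f b + f b * f a = scst (form a b)) ->
  forall i j, (f (beta i) * f (beta j)) ^+ m i j = scst (coxeter_sign i j).
Proof.
move=> fL fC i j; rewrite /coxeter_sign.
have [->|ij] := eqVneq i j.
  by rewrite m_diag (cliff_sq fC (form_beta j)) expr1n scst1.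
have := cheb_mem (m_period ij).
rewrite (cliff_mul_period fC (form_beta i) (form_beta j) (m_period ij)) !inE.
by case/or4P => /eqP -> /=;
  rewrite -signr_odd /= ?expr0 ?expr1 ?opprK ?scstN ?scst1.
Qed.

Definition phi_gen (g : V + 'I_n) : T :=
  match g with
  | inl a => tens (xi a) 1
  | inr i => tens (xi (beta i)) (gelt K (s i))
  end.
Definition phi : S -> T := @plift K (smash_pres form m sigma) T phi_gen.

Lemma xi_homog a : homog true (xi a).
Proof. exact: ppart_class. Qed.

Lemma phi_rel t u : smash_rel form m sigma t u -> teval phi_gen t = teval phi_gen u.
Proof.
case=> [{}t {}u tu|{}t {}u tu|i a].
- rewrite !teval_tmap_comp /=.
  rewrite !(teval_morphism _ _ (tens_l_morphism C W)).
  by congr (tens _ 1); apply: prel_eq.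
- rewrite !teval_tmap_comp /=; case: tu => i j mij; rewrite teval_texp /=;
    rewrite tensM_even tensX_even geltM geltX s_rel (cliff_mul_order cvecL cvecC).
    by rewrite /coxeter_sign mij.
  by rewrite /coxeter_sign ifN //; move: mij; rewrite !inE => /or3P[]/eqP->.
- rewrite /= !tensM_even mul1r mulr1 scstN scst1 mulN1r.
  by rewrite sigmaE (cliff_reflection cvecL cvecC) // mul1r opprK.
Qed.

Lemma phi_homog x : homog (@ppar K (smash_pres form m sigma) x) (phi_gen x).
Proof. by case: x => [a|i]; apply/tens_homog/xi_homog. Qed.

Lemma phi_morphism : superalg_morphism phi.
Proof.
exact: (@plift_morphism K (smash_pres form m sigma) T phi_gen phi_rel phi_homog).
Qed.

Lemma phi_generator x : phi (@pgenerator K (smash_pres form m sigma) x) = phi_gen x.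
Proof. exact: (@plift_gen K (smash_pres form m sigma) T phi_gen phi_rel x). Qed.

Notation iota := (@smash_cliff K V form n m sigma).
Notation theta i := (smash_spn form sigma (spin_t K m i)).

Let iotaM := smash_cliff_morphism form m sigma.
Let thetaM := smash_spn_morphism form m sigma.

Lemma iota_xi a : iota (xi a) = @pgenerator K (smash_pres form m sigma) (inl a).
Proof.
apply: (@plift_gen K (clifford_pres form) S) => t u tu.
by rewrite !teval_tmap; apply/pclassP/teq_rel/smash_clifford.
Qed.

Lemma theta_t i : theta i = @pgenerator K (smash_pres form m sigma) (inr i).
Proof.
apply: (@plift_gen K (spin_pres K m) S) => t u tu.
by rewrite !teval_tmap; apply/pclassP/teq_rel/smash_spin.
Qed.

Lemma iotaL k a b : iota (xi (k *: a + b)) = scst k * iota (xi a) + iota (xi b).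
Proof. by case: iotaM => ic iD iM _; rewrite cvecL iD iM ic. Qed.
Lemma iotaC a b :
  iota (xi a) * iota (xi b) + iota (xi b) * iota (xi a) = scst (form a b).
Proof. by case: iotaM => ic iD iM _; rewrite -!iM -iD cvecC ic. Qed.

Lemma theta_rel i j : (theta i * theta j) ^+ m i j = scst (coxeter_sign i j).
Proof.
case: (thetaM) => tc _ tM _; rewrite -tM -(smorphX _ _ thetaM) -tc.
congr (smash_spn _ _ _).
have [mij|mij] := orP (coxeter_signE i j); rewrite /coxeter_sign.
  rewrite mij; have := @prel_eq _ (spin_pres K m) _ _ (spin_plus K mij).
  by rewrite teval_texp.
rewrite ifN; last by move: mij; rewrite !inE => /or3P[]/eqP->.
have := @prel_eq _ (spin_pres K m) _ _ (spin_minus K mij).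
by rewrite teval_texp.
Qed.

Lemma theta_iota i a : theta i * iota (xi a) = - (iota (xi (sigma i a)) * theta i).
Proof.
rewrite !iota_xi theta_t.
have := @prel_eq _ (smash_pres form m sigma) _ _ (smash_cross form m sigma i a).
by rewrite /= scstN scst1 mulN1r.
Qed.

Definition psi_s (i : 'I_n) : S := iota (xi (beta i)) * theta i.

(** The two reflections, one from conjugation by beta_i and one from conjugation
    by t_i, cancel, and so do their signs. *)
Lemma psi_s_iota i c : psi_s i * iota c = iota c * psi_s i.
Proof.
case: iotaM => ic iD iM _.
elim/(@pclass_ind K (clifford_pres form)): c.
elim=> [a|k|t IHt u IHu|t IHt u IHu].
- rewrite -[pclass _]/(xi a) /psi_s -mulrA theta_iota mulrN !mulrA -mulNr.
  congr (_ * _); rewrite sigmaE (cliffB iotaL) mulrBr scstCA.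
  by rewrite (cliff_sq iotaC) // mulr1 opprB -iotaC addrK.
- by rewrite (ic k : iota (pclass _) = _) scstC.
- by rewrite pclass_Add iD mulrDr mulrDl IHt IHu.
- by rewrite pclass_Mul iM mulrA IHt -mulrA IHu mulrA.
Qed.

(** Since psi_s i commutes with Clifford elements, the product factors as
    (beta_j beta_i) (t_i t_j) with commuting pieces, and the signs of the m-th
    powers of the two factors agree. *)
Lemma psi_rel i j : (psi_s i * psi_s j) ^+ m i j = 1.
Proof.
have E : psi_s i * psi_s j =
    (iota (xi (beta j)) * iota (xi (beta i))) * (theta i * theta j).
  by rewrite {2}/psi_s mulrA psi_s_iota /psi_s !mulrA.
set Y := iota _ * _ in E; set Z := theta i * _ in E.
have comm : psi_s i * psi_s j * Y = Y * (psi_s i * psi_s j).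
  rewrite /Y; case: (iotaM) => _ _ <- _.
  by rewrite -mulrA psi_s_iota mulrA psi_s_iota mulrA.
have pow k : (psi_s i * psi_s j) ^+ k = Y ^+ k * Z ^+ k.
  elim: k => [|k IH]; first by rewrite mulr1.
  rewrite exprS IH mulrA (commrX k comm) -mulrA {1}E -mulrA -exprS.
  by rewrite mulrA -exprSr.
rewrite pow theta_rel /Y m_sym (cliff_mul_order iotaL iotaC) /coxeter_sign m_sym.
by rewrite -scstM; case: ifP => _; rewrite ?mulr1 ?mulrNN ?mulr1 scst1.
Qed.

(** F is the extension of the psi_s i to W, which exists by the presentation of W
    and psi_rel. *)
Section Inverse.
Variable F : W -> S.
Hypothesis F1 : F 1%g = 1.
Hypothesis FM : forall v w, F (v * w)%g = F v * F w.
Hypothesis Fs : forall i, F (s i) = psi_s i.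

Definition psi_group (f : galg K W) : S := \sum_w scst (f w) * F w.
Definition psi (x : T) : S := tlift (fun c f => iota c * psi_group f) x.

Lemma F_iota w c : F w * iota c = iota c * F w.
Proof.
move: w; apply: (gen_ind s_gen) => [|i w IH]; first by rewrite F1 mul1r mulr1.
by rewrite FM Fs -mulrA IH mulrA psi_s_iota mulrA.
Qed.

Lemma F_even w : homog false (F w).
Proof.
move: w; apply: (gen_ind s_gen) => [|i w IH]; first by rewrite F1; apply: homog1.
rewrite FM Fs; apply: (homogM (p := false) _ IH).
case: iotaM => _ _ _ /(_ _ _ (xi_homog (beta i))) hb.
by apply: (homogM (p := true) (q := true) hb); rewrite theta_t; apply/ppart_class.
Qed.

Lemma psi_groupD f g : psi_group (f + g) = psi_group f + psi_group g.
Proof.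
by rewrite -big_split; apply: eq_bigr => w _; rewrite ffunE scstD mulrDl.
Qed.

Lemma psi_group_gelt w : psi_group (gelt K w) = F w.
Proof.
rewrite /psi_group (bigD1 w) //= ffunE eqxx scst1 mul1r big1 ?addr0 // => v vw.
by rewrite ffunE (negPf vw) scst0 mul0r.
Qed.

Lemma psi_groupZ k f : psi_group (scst k * f) = scst k * psi_group f.
Proof.
rewrite mulr_sumr; apply: eq_bigr => w _.
by rewrite [(_ * f) w]gmul_cst scstM mulrA.
Qed.

Lemma psi_group_sum I (r : seq I) (f : I -> galg K W) :
  psi_group (\sum_(i <- r) f i) = \sum_(i <- r) psi_group (f i).
Proof.
apply: (big_morph _ psi_groupD).
by apply: big1 => w _; rewrite ffunE scst0 mul0r.
Qed.

Lemma psi_groupM f g : psi_group (f * g) = psi_group f * psi_group g.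
Proof.
have mulF v : psi_group (gelt K v * g) = F v * psi_group g.
  rewrite {1}(gelt_sum g) mulr_sumr psi_group_sum [in RHS]/psi_group mulr_sumr.
  apply: eq_bigr => w _; rewrite [RHS]scstCA [gelt K v * _]scstCA.
  by rewrite geltM psi_groupZ psi_group_gelt FM.
rewrite {1}(gelt_sum f) mulr_suml psi_group_sum [in RHS]/psi_group mulr_suml.
by apply: eq_bigr => v _; rewrite -!mulrA psi_groupZ mulF.
Qed.

Lemma psi_group_even f : homog false (psi_group f).
Proof.
apply: (big_rec (homog false)) => [|w x _ hx]; first exact: homog0.
by apply: homogD => //; apply/homogZ/F_even.
Qed.

Lemma psi_group_iota f c : psi_group f * iota c = iota c * psi_group f.
Proof.
rewrite mulr_suml mulr_sumr; apply: eq_bigr => w _.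
by rewrite scstCA -!mulrA F_iota.
Qed.

Lemma psi_bal : balanced (fun (c : C) f => iota c * psi_group f).
Proof.
case: iotaM => ic iD iM _.
split=> [c c' f|c f f'|k c f].
- by rewrite iD mulrDl.
- by rewrite psi_groupD mulrDr.
- by rewrite iM ic psi_groupZ scstCA mulrA.
Qed.

Lemma psi_tens c f : psi (tens c f) = iota c * psi_group f.
Proof. exact/tlift_tens/psi_bal. Qed.

Lemma psiD x y : psi (x + y) = psi x + psi y.
Proof. exact/tliftD/psi_bal. Qed.

Lemma psiM x y : psi (x * y) = psi x * psi y.
Proof.
elim/tens_ind: x => [x x' hx hx'|p q a f _ _].
  by rewrite mulrDl !psiD hx hx' mulrDl.
elim/tens_ind: y => [y y' hy hy'|p' q' a' f' _ _].
  by rewrite mulrDr !psiD hy hy' mulrDr.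
rewrite tensM_even !psi_tens psi_groupM; case: iotaM => _ _ -> _.
by rewrite -!mulrA; congr (_ * _); rewrite !mulrA psi_group_iota.
Qed.

Lemma psi_group1 : psi_group 1 = 1.
Proof. by rewrite -[1]/(gelt K 1%g) psi_group_gelt F1. Qed.

Lemma psi_gelt c w : psi (tens c (gelt K w)) = iota c * F w.
Proof. by rewrite psi_tens psi_group_gelt. Qed.

Lemma psi_part p x : psi (spart p x) = spart p (psi x).
Proof.
elim/tens_ind: x => [x y hx hy|q r a f ha _]; first by rewrite !(spartD, psiD) hx hy.
rewrite [spart p (tens a f)](tens_part_homog _ ha (galg_even f)) addbF psi_tens.
case: iotaM => _ _ _ /(_ _ _ ha) hia.
rewrite (spart_homog p (homogM hia (psi_group_even f))) addbF.
case: eqP => // _; first exact: psi_tens.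
by apply: (addrI (psi 0)); rewrite -psiD !addr0.
Qed.

Lemma psi_morphism : superalg_morphism psi.
Proof.
split=> [k|||p x hx]; [|exact: psiD|exact: psiM|]; last first.
  by rewrite /homog -psi_part hx.
rewrite [scst k]/(tens (scst k) 1) psi_tens psi_group1 mulr1; exact: (smorph_cst iotaM).
Qed.

Lemma phi_iota c : phi (iota c) = tens c 1.
Proof.
apply: (palg_morphism_ext (superalg_morphism_comp phi_morphism iotaM)
  (tens_l_morphism C W)) => a.
by rewrite [iota _]iota_xi phi_generator.
Qed.

Lemma phi_theta i : phi (theta i) = tens (xi (beta i)) 1 * tens 1 (gelt K (s i)).
Proof. by rewrite theta_t phi_generator /= tensM_even mul1r mulr1. Qed.

Lemma phi_F w : phi (F w) = tens 1 (gelt K w).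
Proof.
move: w; apply: (gen_ind s_gen) => [|i w IH].
  by rewrite F1 (smorph1 phi_morphism).
rewrite FM Fs /psi_s !(smorphM phi_morphism) IH phi_iota phi_theta !tensM_even.
by rewrite !mulr1 !mul1r geltM (cliff_sq cvecC).
Qed.

Lemma phiK : cancel phi psi.
Proof.
apply: (palg_morphism_ext (superalg_morphism_comp psi_morphism phi_morphism)
  (superalg_morphism_id S)) => -[a|i]; rewrite phi_generator /=.
  by rewrite psi_tens psi_group1 mulr1 iota_xi.
by rewrite psi_gelt Fs mulrA (cliff_sq iotaC) // mul1r theta_t.
Qed.

Lemma psiK : cancel psi phi.
Proof.
elim/tens_ind => [x y hx hy|p q c f _ _].
  by rewrite psiD (smorphD phi_morphism) hx hy.
rewrite psi_tens (smorphM phi_morphism) phi_iota.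
have -> : phi (psi_group f) = tens 1 f.
  rewrite [in RHS](gelt_sum f) tens_sum.
  rewrite /psi_group (big_morph phi (smorphD phi_morphism) (_ : phi 0 = 0)).
    apply: eq_bigr => w _; rewrite (smorphM phi_morphism) (smorph_cst phi_morphism).
    by rewrite phi_F [LHS]tcst_mul tensZ.
  by rewrite -(scst0 S) (smorph_cst phi_morphism) scst0.
by rewrite tensM_even mulr1 mul1r.
Qed.
End Inverse.

Theorem clifford_smash_iso : exists (Phi : S -> T) (Psi : T -> S),
  [/\ superalg_morphism Phi /\ superalg_morphism Psi,
      cancel Phi Psi /\ cancel Psi Phi,
      (forall c, Phi (iota c) = tens c 1) /\
      (forall i, Phi (theta i) = tens (xi (beta i)) 1 * tens 1 (gelt K (s i)))
    & (forall c, Psi (tens c 1) = iota c) /\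
      (forall i, Psi (tens 1 (gelt K (s i))) = iota (xi (beta i)) * theta i)].
Proof.
have [F [F1 FM Fs]] := s_pres psi_rel.
exists phi, (psi F); split.
- by split; [exact: phi_morphism | exact: psi_morphism].
- by split; [exact: phiK | exact: psiK].
- by split; [exact: phi_iota | exact: phi_theta].
- split=> [c|i]; first by rewrite psi_tens psi_group1 // mulr1.
  by rewrite psi_gelt Fs (smorph1 iotaM) mul1r.
Qed.


End Iso.

(** * Root bases in real space: simple Lie types and gl_n *)

Section Dot.
Variables (K : fieldType) (N : nat).
Implicit Types a b c : 'rV[K]_N.

Lemma dotC a b : dot a b = dot b a.
Proof. by apply: eq_bigr => j _; rewrite mulrC. Qed.

Lemma dotDl a b c : dot (a + b) c = dot a c + dot b c.
Proof. by rewrite -big_split; apply: eq_bigr => j _; rewrite mxE mulrDl. Qed.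

Lemma dotZl k a b : dot (k *: a) b = k * dot a b.
Proof. by rewrite mulr_sumr; apply: eq_bigr => j _; rewrite mxE mulrA. Qed.

Lemma dotZr k a b : dot a (k *: b) = k * dot a b.
Proof. by rewrite dotC dotZl dotC. Qed.

Lemma dotNl a b : dot (- a) b = - dot a b.
Proof. by rewrite -scaleN1r dotZl mulN1r. Qed.

Lemma dot_deltal j a : dot (delta_mx 0 j) a = a 0 j.
Proof.
rewrite /dot (bigD1 j) //= mxE !eqxx mul1r big1 ?addr0 // => k /negPf kj.
by rewrite mxE kj andbF mul0r.
Qed.

Lemma reflectionD a b c : reflection a (b + c) = reflection a b + reflection a c.
Proof.
by rewrite /reflection dotDl mulrDr mulrDl scalerDl opprD addrACA.
Qed.

Lemma reflectionN a b : reflection a (- b) = - reflection a b.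
Proof.
by rewrite /reflection dotNl mulrN mulNr scaleNr -opprD.
Qed.
End Dot.

Section RealRoots.
Variables (R : realType).

Lemma dot_gt0 N (a : 'rV[R]_N) : a != 0 -> 0 < dot a a.
Proof.
move=> a0; rewrite lt0r sumr_ge0 => [|j _]; last by rewrite -expr2 sqr_ge0.
rewrite andbT; apply: contraNneq a0 => /eqP.
rewrite psumr_eq0 => [/allP h|j _]; last by rewrite -expr2 sqr_ge0.
apply/eqP/rowP => j; rewrite mxE; apply/eqP.
by have := h j (mem_index_enum j); rewrite -expr2 sqrf_eq0.
Qed.

(** What the two kinds of simple roots, of simple Lie type and of gl_n, have in
    common; u is the dual family of vectors. *)
Record root_basis (N n : nat) (Phi : seq 'rV[R]_N) (alpha u : 'I_n -> 'rV[R]_N) :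
    Prop := RootBasis {
  rb_simple : forall i, alpha i \in Phi;
  rb_neq0 : 0 \notin Phi;
  rb_refl : forall i a, a \in Phi -> reflection (alpha i) a \in Phi;
  rb_reduced : forall i k, k *: alpha i \in Phi -> k = 1 \/ k = -1;
  rb_base : forall a, a \in Phi -> exists c : 'I_n -> nat,
    a = \sum_i (c i)%:R *: alpha i \/ a = - \sum_i (c i)%:R *: alpha i;
  rb_dual : forall i j, dot (alpha j) (u i) = (i == j)%:R
}.

(** The coordinate forms of the free family of simple roots are represented by
    vectors through the standard dot product. *)
Lemma simple_system_basis N n (Phi : seq 'rV[R]_N) (alpha : 'I_n -> 'rV[R]_N) :
  irreducible_root_system Phi -> simple_system Phi alpha ->
  exists u, root_basis Phi alpha u.
Proof.
move=> PhiP simP; pose X := [tuple alpha i | i < n].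
have freeX : free X by have := simple_free simP.
exists (fun i => \row_j coord X i (delta_mx 0 j)); split.
- exact: simple_root simP.
- exact: roots_neq0 PhiP.
- by move=> i a aP; apply: (roots_reflection PhiP) => //; apply: (simple_root simP).
- by move=> i k; apply: (roots_reduced PhiP); apply: (simple_root simP).
- by move=> a aP; apply: (simple_base simP).
move=> i j; rewrite eq_sym -(coord_free j i freeX) -tnth_nth tnth_mktuple.
rewrite [in RHS](row_sum_delta (alpha j)) linear_sum; apply: eq_bigr => k _.
by rewrite mxE linearZ.
Qed.

Section GeneralLinear.
Variables (n : nat) (alpha : 'I_n -> 'rV[R]_n.+1).
Hypothesis alphaE : forall i (j : 'I_n.+1),
  alpha i 0 j = ((j : nat) == i)%:R - ((j : nat) == i.+1)%:R.

Notation e p := (delta_mx 0 p : 'rV[R]_n.+1).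

(** The roots e_p - e_q, so that gl_n is treated as a root basis like the others. *)
Definition gl_roots : seq 'rV[R]_n.+1 :=
  [seq e p.1 - e p.2 | p <- enum [pred p : 'I_n.+1 * 'I_n.+1 | p.1 != p.2]].

Lemma gl_rootsP a :
  reflect (exists p q, p != q /\ a = e p - e q) (a \in gl_roots).
Proof.
apply: (iffP mapP) => [[[p q]]|[p [q [pq ->]]]].
  by rewrite mem_enum => pq ->; exists p, q.
by exists (p, q); rewrite ?mem_enum.
Qed.

Lemma alpha_e i : alpha i = e (widen_ord (leqnSn n) i) - e (lift ord0 i).
Proof. by apply/rowP => j; rewrite alphaE !mxE -!val_eqE. Qed.

Lemma reflection_e x y p : x != y -> reflection (e x - e y) (e p) = e (tperm x y p).
Proof.
move=> xy; rewrite /reflection dot_deltal dotDl dotNl !dot_deltal.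
rewrite !mxE !eqxx [y == x]eq_sym (negPf xy) /= !subr0 sub0r opprK.
rewrite [2 * _ / _](_ : _ = (p == x)%:R - (p == y)%:R); last by field.
case: tpermP => [->|->|/eqP/negPf -> /eqP/negPf ->].
- by rewrite eqxx (negPf xy) subr0 scale1r opprB addrCA subrr addr0.
- by rewrite eqxx eq_sym (negPf xy) sub0r scaleN1r opprK addrCA subrr addr0.
- by rewrite subrr scale0r subr0.
Qed.

Lemma gl_telescope (p q : 'I_n.+1) : (p <= q)%N ->
  e p - e q = \sum_(k < n) (p <= k < q)%:R *: alpha k.
Proof.
move=> pq; pose E k := e (inord k).
have aE (k : 'I_n) : alpha k = E k - E k.+1.
  rewrite alpha_e /E; congr (e _ - e _); apply/val_inj; rewrite /= inordK // ltnS //.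
  exact: ltnW.
transitivity (\sum_(k < n | (p <= k < q)%N) (E k - E k.+1)); last first.
  rewrite big_mkcond; apply: eq_bigr => k _; rewrite aE.
  by case: ifP; rewrite ?scale1r ?scale0r.
rewrite -(big_mkord (fun k => (p <= k < q)%N) (fun k => E k - E k.+1)).
have qn : (q <= n)%N by rewrite -ltnS.
have -> : \sum_(0 <= k < n | (p <= k < q)%N) (E k - E k.+1) =
          \sum_(p <= k < q) (E k - E k.+1).
  by rewrite (big_nat_widenl p 0 q) // (big_nat_widen 0 q n) //.
rewrite (eq_bigr (fun k => - (E k.+1 - E k))) => [|k _]; last by rewrite opprB.
by rewrite sumrN telescope_sumr // opprB /E !inord_val.
Qed.

(** The dual vector of e_i - e_(i+1) is e_0 + ... + e_i. *)
Lemma gl_basis : root_basis gl_roots alpha (fun i => \row_j (j <= i)%:R).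
Proof.
have xy (i : 'I_n) : widen_ord (leqnSn n) i != lift ord0 i.
  by rewrite -val_eqE /= neq_ltn ltnS leqnn.
have n0 : 0 \notin gl_roots.
  apply/gl_rootsP => -[p [q [pq /rowP/(_ p)/eqP]]].
  by rewrite !mxE !eqxx (negPf pq) subr0 eq_sym oner_eq0.
split=> //.
- move=> i; apply/gl_rootsP.
  exists (widen_ord (leqnSn n) i), (lift ord0 i); split; [exact: xy | exact: alpha_e].
- move=> i a /gl_rootsP[p [q [pq ->]]]; rewrite alpha_e reflectionD reflectionN.
  rewrite !reflection_e //; apply/gl_rootsP; set t := tperm _ _.
  by exists (t p), (t q); rewrite (inj_eq perm_inj).
- move=> i k kP; have /gl_rootsP[p [q [pq]]] := kP.
  rewrite alpha_e => /rowP/(_ (widen_ord (leqnSn n) i)).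
  rewrite !mxE !eqxx (negPf (xy i)) subr0 mulr1.
  case: eqP; case: eqP => _ _; rewrite ?subr0 ?sub0r ?subrr; [|by left|by right|].
    by move=> k0; move: kP; rewrite k0 scale0r (negPf n0).
  by move=> k0; move: kP; rewrite k0 scale0r (negPf n0).
- move=> a /gl_rootsP[p [q [pq ->]]].
  have [le|lt] := leqP p q.
    by exists (fun k => (p <= k < q)%N : nat); left; apply: gl_telescope.
  exists (fun k => (q <= k < p)%N : nat); right.
  by rewrite -gl_telescope ?opprB // ltnW.
- move=> i j; rewrite alpha_e dotDl dotNl !dot_deltal !mxE /= /bump /= add1n.
  by rewrite -val_eqE /=; case: (ltngtP i j) => _; rewrite ?subrr ?subr0.
Qed.
End GeneralLinear.

Lemma weyl_root_basis N n (alpha : 'I_n -> 'rV[R]_N) (U : {vspace 'rV[R[i]]_N}) :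
  weyl_roots alpha U -> exists Phi u, root_basis Phi alpha u.
Proof.
case=> [Phi PhiP simP|eN].
  by have [u uP] := simple_system_basis PhiP simP; exists Phi, u.
subst N => alphaE; do 2!eexists; exact: (gl_basis alphaE).
Qed.

Lemma weyl_root_mem N n (alpha : 'I_n -> 'rV[R]_N) (U : {vspace 'rV[R[i]]_N}) i :
  weyl_roots alpha U -> cplx (alpha i) \in U.
Proof.
by case=> [Phi _ _|_ _]; [apply/memv_span/map_f; rewrite mem_enum|apply: memvf].
Qed.

End RealRoots.

(** * From real root bases to the complex reflection representation *)

(** Strict Cauchy-Schwarz: the component of x orthogonal to y has squared length
    2 - (x, y)^2 / 2. *)
Lemma dot_acute (R : realType) N (x y : 'rV[R]_N) :
  dot x x = 2 -> dot y y = 2 -> x - (dot x y / 2) *: y != 0 -> dot x y ^+ 2 < 4.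
Proof.
move=> xx yy /dot_gt0; rewrite -scaleNr dotDl dotZl.
rewrite [dot x _]dotC [dot y _]dotC !dotDl !dotZl xx yy (dotC y x) => h.
nra.
Qed.

Section Complexify.
Variables (R : realType) (W : weyl_group R).
Notation C := R[i].
Notation N := (wdim W).
Notation n := (wrank W).
Notation alpha := (@wroot R W).
Notation toC := (real_complex R).
Notation b := (@beta R W).

Lemma cplxZ k (a : 'rV[R]_N) : cplx (k *: a) = toC k *: cplx a.
Proof. exact: map_mxZ. Qed.

Lemma cplx_inj : injective (@cplx R N).
Proof. exact/map_mx_inj. Qed.

Lemma dot_cplx (a b : 'rV[R]_N) : dot (cplx a) (cplx b) = toC (dot a b).
Proof. by rewrite rmorph_sum; apply: eq_bigr => j _; rewrite !mxE rmorphM. Qed.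

Lemma reflection_cplx (a b : 'rV[R]_N) :
  reflection (cplx a) (cplx b) = cplx (reflection a b).
Proof.
rewrite /reflection !dot_cplx /cplx map_mxB map_mxZ; congr (_ - _ *: _).
by rewrite rmorphM fmorphV rmorphM rmorph_nat.
Qed.

Variables (Phi : seq 'rV[R]_N) (u : 'I_n -> 'rV[R]_N).
Hypothesis basisP : root_basis Phi alpha u.

Let alpha_gt0 i : 0 < dot (alpha i) (alpha i).
Proof.
apply: dot_gt0; have h := rb_simple basisP i.
by apply: contraNneq (rb_neq0 basisP) => <-.
Qed.

Definition root_scale i : R := Num.sqrt (2 / dot (alpha i) (alpha i)).

Lemma root_scale_gt0 i : 0 < root_scale i.
Proof. by rewrite sqrtr_gt0 divr_gt0. Qed.

Lemma root_scale_sq i : root_scale i ^+ 2 * dot (alpha i) (alpha i) = 2.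
Proof. by rewrite sqr_sqrtr ?divfK ?gt_eqF // divr_ge0 // ltW. Qed.

Lemma hform_beta i : hform (b i) (b i) = 2.
Proof.
rewrite /hform vsval_beta /beta_vector -/(root_scale i) dot_cplx dotZl dotZr.
by rewrite mulrA -expr2 root_scale_sq rmorph_nat.
Qed.

Lemma wact_reflection i (a : hdual W) :
  wact (wrefl i) a = a - hform a (b i) *: b i.
Proof.
apply: subvs_inj; rewrite wact_refl.
have -> : vsval (a - hform a (b i) *: b i) = vsval a - hform a (b i) *: vsval (b i).
  by [].
rewrite vsval_beta /hform vsval_beta /beta_vector -/(root_scale i) !cplxZ dotZr scalerA.
rewrite /reflection; congr (_ - _ *: _); rewrite mulrAC dot_cplx.
have -> : toC (root_scale i) * dot (vsval a) (cplx (alpha i)) * toC (root_scale i) =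
    toC (root_scale i ^+ 2) * dot (vsval a) (cplx (alpha i)).
  by rewrite expr2 rmorphM mulrAC.
rewrite sqr_sqrtr; last by rewrite divr_ge0 // ltW.
by rewrite fmorph_div rmorph_nat.
Qed.

(** The real dual vectors still represent the coordinates of roots after extension
    of scalars, which gives freeness over the complex numbers. *)
Definition dual_form i (a : hdual W) : C := dot (vsval a) (cplx (u i)).
Fact dual_form_linear i : scalar (dual_form i).
Proof. by move=> k a c; rewrite /dual_form linearP dotDl dotZl. Qed.
HB.instance Definition _ i :=
  GRing.isLinear.Build C (hdual W) C _ (dual_form i) (dual_form_linear i).

(** The projection is the identity on the complex span of the roots (hrootK). *)
Definition hroot (a : 'rV[R]_N) : hdual W := vsproj (wspace W) (cplx a).

Lemma cplx_base (c : 'I_n -> nat) :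
  cplx (\sum_i (c i)%:R *: alpha i) = \sum_i (c i)%:R *: cplx (alpha i).
Proof.
rewrite /cplx raddf_sum; apply: eq_bigr => i _.
by rewrite /= [LHS]cplxZ rmorph_nat.
Qed.

Lemma cplxN (a : 'rV[R]_N) : cplx (- a) = - cplx a.
Proof. exact: map_mxN. Qed.

Lemma hrootK a : a \in Phi -> vsval (hroot a) = cplx a.
Proof.
move=> aP; apply: vsprojK.
have sumP (c : 'I_n -> nat) : cplx (\sum_i (c i)%:R *: alpha i) \in wspace W.
  rewrite cplx_base; apply: memv_suml => i _.
  exact/memvZ/(weyl_root_mem _ (wrootP W)).
by have [c [->|->]] := rb_base basisP aP; rewrite ?cplxN ?memvN.
Qed.

Lemma scale_beta i : toC (root_scale i)^-1 *: b i = hroot (alpha i).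
Proof.
apply: subvs_inj; rewrite (hrootK (rb_simple basisP i)).
have -> : vsval (toC (root_scale i)^-1 *: b i) = toC (root_scale i)^-1 *: vsval (b i).
  by [].
rewrite vsval_beta /beta_vector -/(root_scale i) -cplxZ scalerA mulVf ?scale1r //.
by rewrite gt_eqF ?root_scale_gt0.
Qed.

Lemma hform_acute i j : i != j -> hform (b i) (b j) ^+ 2 < 4.
Proof.
move=> ij; rewrite /hform !vsval_beta /beta_vector -!/(root_scale _) dot_cplx.
set x := root_scale i *: alpha i; set y := root_scale j *: alpha j.
have xx : dot x x = 2 by rewrite dotZl dotZr mulrA -expr2 root_scale_sq.
have yy : dot y y = 2 by rewrite dotZl dotZr mulrA -expr2 root_scale_sq.
rewrite -rmorphXn -[4](rmorph_nat toC 4) ltcR.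
apply: dot_acute => //.
apply/eqP => /(congr1 (fun z => dot z (u i))).
rewrite -scaleNr dotDl !dotZl !(rb_dual basisP).
rewrite eqxx (negPf ij) !mulr0 addr0 mulr1 -[0](scale0r 0) dotZl mul0r => /eqP.
by rewrite gt_eqF ?root_scale_gt0.
Qed.

(** A complex multiple of a root that is a root is a real multiple, the scalar
    being read off as a dual coordinate; the other conditions are those of the
    real root basis. *)
Lemma hdual_based_roots : based_roots (@hform R W) b
  [seq hroot a | a <- Phi] (fun i => toC (root_scale i)^-1) dual_form.
Proof.
have aP i : alpha i \in Phi := rb_simple basisP i.
split=> [i|i||i v|i k|v|i j|i j].
- by rewrite ltcR invr_gt0 root_scale_gt0.
- by rewrite scale_beta map_f.
- apply/mapP => -[a ain /(congr1 vsval)]; rewrite hrootK // => a0.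
  have : 0 = a by apply: cplx_inj; rewrite -a0 /cplx raddf0.
  by move=> ea; have := rb_neq0 basisP; rewrite ea ain.
- case/mapP => a ain ->; apply/mapP; exists (reflection (alpha i) a).
    exact: (rb_refl basisP).
  apply: subvs_inj; rewrite hrootK ?(rb_refl basisP) // -reflection_cplx.
  by rewrite /refl -wact_reflection wact_refl hrootK.
- rewrite scale_beta => /mapP[a ain /(congr1 vsval)]; rewrite hrootK //.
  have -> : vsval (k *: hroot (alpha i)) = k *: vsval (hroot (alpha i)) by [].
  rewrite hrootK // => ka.
  have := congr1 (fun z => dot z (cplx (u i))) ka; rewrite dotZl !dot_cplx.
  rewrite (rb_dual basisP) eqxx rmorph1 mulr1 => kE.
  have ea : dot a (u i) *: alpha i = a by apply: cplx_inj; rewrite cplxZ -kE.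
  have := rb_reduced basisP (i := i) (k := dot a (u i)); rewrite ea => /(_ ain).
  by rewrite kE; case=> ->; [left|right]; rewrite ?rmorphN rmorph1.
- case/mapP => a ain ->; have [c ac] := rb_base basisP ain; exists c.
  have sE : vsval (\sum_i (c i)%:R *: (toC (root_scale i)^-1 *: b i)) =
      cplx (\sum_i (c i)%:R *: alpha i).
    rewrite cplx_base raddf_sum; apply: eq_bigr => i _.
    by rewrite scale_beta /= hrootK.
  case: ac => ac; [left|right]; apply: subvs_inj; rewrite hrootK // ac.
    by rewrite -sE.
  by rewrite cplxN -sE.
- rewrite scale_beta -[LHS]/(dot (vsval (hroot (alpha j))) (cplx (u i))) hrootK //.
  by rewrite dot_cplx (rb_dual basisP) rmorph_nat.
- exact: hform_acute.
Qed.

End Complexify.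

Theorem theorem2p3 (R : realType) (W : weyl_group R) :
  exists (Phi : weyl_smash W -> weyl_tensor W)
         (Psi : weyl_tensor W -> weyl_smash W),
    [/\ superalg_morphism Phi /\ superalg_morphism Psi,
        cancel Phi Psi /\ cancel Psi Phi,
        (forall c : weyl_clifford W, Phi (smash_c c) = tensor_c c) /\
        (forall i : 'I_(wrank W),
           Phi (smash_t i) = tensor_c (cbeta i) * tensor_w (wrefl i))
      & (forall c : weyl_clifford W, Psi (tensor_c c) = smash_c c) /\
        (forall i : 'I_(wrank W),
           Psi (tensor_w (wrefl i)) = smash_c (cbeta i) * smash_t i)].
Proof.
have [Phi [u basisP]] := weyl_root_basis (wrootP W).
have rootsP := hdual_based_roots basisP.
have formDl (a b c : hdual W) : hform (a + b) c = hform a c + hform b c.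
  exact: (dotDl (vsval a) (vsval b) (vsval c)).
have formZl k (a b : hdual W) : hform (k *: a) b = k * hform a b.
  exact: (dotZl k (vsval a) (vsval b)).
have formC (a b : hdual W) : hform a b = hform b a := dotC _ _.
pose act (w : W) : {linear hdual W -> hdual W} := wact w.
have act1 v : act 1%g v = v by rewrite /act /= wact1 id_lfunE.
have actM v w a : act (v * w)%g a = act v (act w a) by rewrite /act /= wactM comp_lfunE.
have act_inj v w : act v =1 act w -> v = w by move=> e; apply/wact_inj/lfunP.
have act_s i a : act (wrefl i) a = refl (@hform R W) (@beta R W) i a.
  exact: (wact_reflection basisP i a).
have fb := hform_beta basisP.
have gen := @wrefl_gen R W.
have ss := s_inv formDl formZl fb act1 actM act_inj act_s.
apply: (@clifford_smash_iso _ _ (@hform R W) _ (@beta R W) (@coxeter_m R W) W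
  (@wrefl R W) _ fb (wact_reflection basisP)) => //.
- by move=> i; rewrite /coxeter_m ss order1.
- by move=> i j; rewrite /coxeter_m -orderV invMg; congr #[_ * _]%g;
    apply/eqP; rewrite eq_invg_mul; apply/eqP/ss.
- move=> i j ij; have [m per] := bond_period formZl formC rootsP ij.
  by rewrite /coxeter_m
    (bond_order formDl formZl formC fb rootsP act1 actM act_inj act_s ij per).
- by move=> i j; apply: expg_order.
exact: (reflection_presentation formDl formZl formC fb rootsP gen
          act1 actM act_inj act_s).
Qed.
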